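(* Let $(z_k)_{k\ge 0}=(x_k,y_k)_{k\ge0}$ be the iterates of PURE-CD (the algorithm described in the context) started from an arbitrary $z_0\in\mathcal Z$, where $\theta_j=\pi_j/\underline p$ for all $j$, and the step sizes $\tau_i,\sigma_j>0$ satisfy, for every $i\in\{1,\dots,n\}$, $$\tau_i<\frac{2p_i-\underline p}{\beta_i p_i+\underline p^{-1}p_i\sum_{j=1}^m\pi_j\sigma_jA_{j,i}^2}.$$ Then, almost surely, there exists $z_\star=(x_\star,y_\star)\in\mathcal Z_\star$ (possibly depending on the realization) such that $z_k\to z_\star$.
   Context: Setting. $\mathcal X=\prod_{i=1}^n\mathcal X_i$ and $\mathcal Y=\prod_{j=1}^m\mathcal Y_j$ are products of Euclidean spaces, $\mathcal Z=\mathcal X\times\mathcal Y$; $x^i$ (or $x_i$) and $y^j$ denote blocks. $A:\mathcal X\to\mathcal Y$ is linear with blocks $A_{j,i}:\mathcal X_i\to\mathcal Y_j$; $A_{j,i}^2$ denotes the squared operator norm of $A_{j,i}$ (the squared entry when blocks are one-dimensional). The problem is $\min_{x\in\mathcal X} f(x)+g(x)+h(Ax)$. Standing assumptions. (i) $f,g:\mathcal X\to\mathbb R\cup\{+\infty\}$ and $h:\mathcal Y\to\mathbb R\cup\{+\infty\}$ are proper, lower semicontinuous, convex. (ii) $g(x)=\sum_{i=1}^n g_i(x_i)$; $f$ is finite and differentiable with coordinatewise Lipschitz gradients: for all $x\in\mathcal X$, all $i$, all $u\in\mathcal X_i$, $f(x+U_i(u))\le f(x)+\langle\nabla_if(x),u\rangle+\frac{\beta_i}{2}\|u\|^2$,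 where $U_i(u)\in\mathcal X$ has block $i$ equal to $u$ and all other blocks $0$. (iii) The set $\mathcal Z_\star$ of $z_\star=(x_\star,y_\star)$ with $0\in\nabla f(x_\star)+\partial g(x_\star)+A^\top y_\star$ and $0\in Ax_\star-\partial h^*(y_\star)$ is nonempty. (iv) $0\in\mathrm{ri}(\mathrm{dom}\,h-A\,\mathrm{dom}\,g)$. Probabilities. $p_1,\dots,p_n>0$, $\sum_ip_i=1$, $\underline p=\min_ip_i$. $J(i)=\{j:A_{j,i}\ne0\}$, $I(j)=\{i:A_{j,i}\neq0\}$, $\pi_j=\sum_{i\in I(j)}p_i$. $A$ has no zero row, so $\pi_j>0$ for all $j$. Notation. Diagonal matrices act blockwise. For positive definite $V$, $\mathrm{prox}_{V,\varphi}(v)=\arg\min_u\varphi(u)+\frac12\|u-v\|^2_{V^{-1}}$ with $\|u\|_V^2=\langle u,Vu\rangle$. Algorithm (PURE-CD). Positive diagonal matrices $\theta=\mathrm{diag}(\theta_j)$, $\tau=\mathrm{diag}(\tau_i)$, $\sigma=\mathrm{diag}(\sigma_j)$. From $z_0=(x_0,y_0)$, for $k=0,1,\dots$: $\bar y_{k+1}=\mathrm{prox}_{\sigma,h^*}(y_k+\sigma Ax_k)$; $\bar x_{k+1}=\mathrm{prox}_{\tau,g}(x_k-\tau(\nabla f(x_k)+A^\top\bar y_{k+1}))$; draw $i_{k+1}\in\{1,\dots,n\}$, independently of the past, with $\mathbb P(i_{k+1}=i)=p_i$; $x_{k+1}^{i_{k+1}}=\bar x_{k+1}^{i_{k+1}}$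 and $x_{k+1}^{l}=x_k^{l}$ for $l\ne i_{k+1}$; $y_{k+1}^j=\bar y_{k+1}^j+\sigma_j\theta_j(A(x_{k+1}-x_k))_j$ for $j\in J(i_{k+1})$ and $y_{k+1}^j=y_k^j$ for $j\notin J(i_{k+1})$. *)

(* Defs.v *)
From HB Require Import structures.
From mathcomp Require Import all_boot all_order all_algebra.
From mathcomp Require Import all_classical all_reals all_analysis.

Set Implicit Arguments.
Unset Strict Implicit.
Unset Printing Implicit Defensive.

Import Order.TTheory GRing.Theory Num.Theory.
Import numFieldNormedType.Exports.

Local Open Scope classical_set_scope.
Local Open Scope ring_scope.

(* A product of n Euclidean spaces R^(d 0) x ... x R^(d (n-1)) is the space of
   column vectors of size \sum_i d i: block i of x is [submxcol x i], block
   (j, i) of a matrix A is [submxblock A j i], and [\mxcol_i u i] is the vector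
   with blocks u i. *)
Notation bvec R d := 'cV[R]_(\sum_i d i)%N.

Definition dot (R : realType) (N : nat) (u v : 'cV[R]_N) : R := (u^T *m v) 0 0.

(* The norm of the normedModType 'cV[R]_N is the sup norm (it induces the same
   topology), hence a separate Euclidean norm. *)
Definition enorm (R : realType) (N : nat) (u : 'cV[R]_N) : R :=
  Num.sqrt (dot u u).

Definition opnorm (R : realType) (M N : nat) (B : 'M[R]_(M, N)) : R :=
  sup [set enorm (B *m u) | u in [set u : 'cV[R]_N | enorm u <= 1]].

Definition wnormsq (R : realType) (N : nat) (V : 'M[R]_N) (u : 'cV[R]_N) : R :=
  dot u (V *m u).

(* U_i(u): block i is u, the other blocks are 0. *)
Definition Ublock (R : realType) (n : nat) (d : 'I_n -> nat) (i : 'I_n)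
    (u : 'cV[R]_(d i)) : bvec R d :=
  \mxcol_l @dfwith _ (fun l => 'cV[R]_(d l)) (fun=> 0) i u l.

Definition blockdiag (R : realType) (n : nat) (d : 'I_n -> nat)
    (t : 'I_n -> R) : 'M[R]_(\sum_i d i)%N :=
  \mxdiag_i ((t i)%:M : 'M[R]_(d i)).

Definition grad (R : realType) (N : nat) (f : 'cV[R]_N -> R) (x : 'cV[R]_N) :
    'cV[R]_N :=
  \col_a 'D_(delta_mx a 0) f x.

Section ConvexAnalysis.
Context {R : realType} {N : nat}.
Implicit Types (phi : 'cV[R]_N -> \bar R) (C : set 'cV[R]_N).

Definition edom phi : set 'cV[R]_N := [set x | (phi x < +oo)%E].

Definition eproper phi : Prop :=
  (forall x, phi x != -oo%E) /\ edom phi !=set0.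

(* With 0 * +oo = 0, the cases t = 0 and t = 1 are trivial. *)
Definition econvex phi : Prop :=
  forall (x y : 'cV[R]_N) (t : R), 0 <= t <= 1 ->
    (phi (t *: x + (1 - t) *: y)%R <= t%:E * phi x + (1 - t)%:E * phi y)%E.

Definition proper_lsc_convex phi : Prop :=
  [/\ eproper phi, lower_semicontinuous phi & econvex phi].

Definition conjugate phi (y : 'cV[R]_N) : \bar R :=
  ereal_sup [set ((dot y u)%:E - phi u)%E | u in setT].

Definition subdiff phi (x : 'cV[R]_N) : set 'cV[R]_N :=
  [set v | forall w, (phi x + (dot v (w - x))%:E <= phi w)%E].

Definition argmin phi : set 'cV[R]_N :=
  [set u | forall w, (phi u <= phi w)%E].

(* For V positive definite and phi proper, lsc and convex, the argmin is a
   singleton; the default value 0 is then never used. *)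
Definition prox (V : 'M[R]_N) phi (v : 'cV[R]_N) : 'cV[R]_N :=
  xget 0 (argmin (fun u =>
    (phi u + (2^-1 * wnormsq (invmx V) (u - v))%:E)%E)).

Definition affine_hull C : set 'cV[R]_N :=
  [set x | exists k (a : 'I_k -> 'cV[R]_N) (w : 'I_k -> R),
    [/\ forall l, C (a l), \sum_l w l = 1 & x = \sum_l w l *: a l]].

Definition relint C : set 'cV[R]_N :=
  [set x | affine_hull C x /\ \forall z \near x, affine_hull C z -> C z].

End ConvexAnalysis.

Definition saddle_points (R : realType) (N M : nat) (f : 'cV[R]_N -> R)
    (g : 'cV[R]_N -> \bar R) (h : 'cV[R]_M -> \bar R) (A : 'M[R]_(M, N)) :
    set ('cV[R]_N * 'cV[R]_M) :=
  [set z | (exists2 v, subdiff g z.1 v & 0 = grad f z.1 + v + A^T *m z.2) /\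
           (exists2 w, subdiff (conjugate h) z.2 w & 0 = A *m z.1 - w)].

(* The minimum of the p i, since p i <= 1 for probabilities (the unit 1 never
   wins strictly). *)
Definition pmin (R : realType) (n : nat) (p : 'I_n -> R) : R :=
  \big[Num.min/1]_i p i.

(* pi_j: the probability that dual block j is updated. *)
Definition pi_dual (R : realType) (n m : nat) (d : 'I_n -> nat)
    (e : 'I_m -> nat) (A : 'M[R]_(\sum_j e j, \sum_i d i)%N) (p : 'I_n -> R)
    (j : 'I_m) : R :=
  \sum_(i | submxblock A j i != 0) p i.

Section Algorithm.
Context {R : realType} {n m : nat} {d : 'I_n -> nat} {e : 'I_m -> nat}.
Variables (f : bvec R d -> R) (g : bvec R d -> \bar R) (h : bvec R e -> \bar R).
Variables (A : 'M[R]_(\sum_j e j, \sum_i d i)%N).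
Variables (theta : 'I_m -> R) (tau : 'I_n -> R) (sigma : 'I_m -> R).

Definition ybar (x : bvec R d) (y : bvec R e) : bvec R e :=
  prox (blockdiag e sigma) (conjugate h) (y + blockdiag e sigma *m (A *m x)).

Definition xbar (x : bvec R d) (y : bvec R e) : bvec R d :=
  prox (blockdiag d tau) g
    (x - blockdiag d tau *m (grad f x + A^T *m ybar x y)).

Definition purecd_step (z : bvec R d * bvec R e) (i : 'I_n) :
    bvec R d * bvec R e :=
  let: (x, y) := z in
  let x' : bvec R d :=
    \mxcol_l (if l == i then submxcol (xbar x y) l else submxcol x l) in
  let y' : bvec R e :=
    \mxcol_j (if submxblock A j i != 0
              then submxcol (ybar x y) j
                   + (sigma j * theta j) *: submxcol (A *m (x' - x)) j
              else submxcol y j) in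
  (x', y').

(* [s k] is the coordinate i_(k+1) drawn at iteration k. *)
Fixpoint purecd (z0 : bvec R d * bvec R e) (s : nat -> 'I_n) (k : nat) :
    bvec R d * bvec R e :=
  if k is k'.+1 then purecd_step (purecd z0 s k') (s k') else z0.

End Algorithm.

(* [xi k] is the random index i_(k+1), of law p and independent of the past:
   z_0 being deterministic, the events of the past are those determined by
   (xi 0, ..., xi (k-1)). *)
Definition random_draws (R : realType) (dT : measure_display)
    (T : measurableType dT) (P : probability T R) (n : nat) (p : 'I_n -> R)
    (xi : nat -> T -> 'I_n) : Prop :=
  [/\ forall k i, measurable (xi k @^-1` [set i]),
      forall k i, P (xi k @^-1` [set i]) = (p i)%:E
    & forall k (B : set (seq 'I_n)) i,
        let past := [set w | B (mkseq (fun l => xi l w) k)] in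
        P (past `&` xi k @^-1` [set i]) = (P past * P (xi k @^-1` [set i]))%E].

(* Main.v *)
Require Import Defs.
From HB Require Import structures.
From mathcomp Require Import all_boot all_order all_algebra.
From mathcomp Require Import all_classical all_reals all_analysis.
From mathcomp Require Import ring lra.
Import Order.TTheory GRing.Theory Num.Theory.
Import numFieldNormedType.Exports.
Local Open Scope classical_set_scope.
Local Open Scope ring_scope.

(** The iterates are compared with a fixed saddle point [zs = (xs, ys)] through
    a Lyapunov function that adds two squared distances, in which the weight of a
    block is divided by its update probability, and two nonnegative gaps
    at [zs]: the Bregman distance of [f], and blockwise the gap of [g], weighted by
    [1 / pmin p - 1 / p i]. Conditionally on the past, its expectation decreases
    by an amount [decrease] that controls the lengths of both proximal steps and
    the gaps of [f] and [g] (lemma [lyapunov_decrease]). The proof adds up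
    the subgradient inequalities of the two proximal points at [zs]; the choice
    of [theta] turns the dual cross term into one with blockwise factors
    [p i / pmin p - 1], which the proximal inequality of block [i] at the current
    point absorbs. The bound on [tau i] is exactly what makes the
    remaining multiple of the squared step of block [i] positive.

    A nonnegative supermartingale converges almost surely. As the draws take
    finitely many values, a process is a function on the tree of finite sequences
    of draws, and expectations are finite sums. Ville's inequality shows that
    a nonnegative supermartingale is almost surely bounded; applied to the capital
    of a player who bets on upcrossings, it gives Doob's theorem
    (lemma [supermartingale_cvg]). Hence, almost surely, the Lyapunov function
    converges and the decreases are summable, simultaneously for a countable
    dense set of saddle points.

    On such a realization in which moreover every block is drawn infinitely
    often, the gaps at the iterates vanish, so that the weighted distances to the
    saddle points of the dense set converge. The proximal steps vanish too, so
    every cluster point satisfies the optimality conditions, by closedness of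
    subdifferentials and continuity of the gradient of a convex function
    (lemma [path_cluster]). Opial's argument then identifies the limit
    (lemma [path_cvg]).

    The Lyapunov function requires [g] to be finite at the starting point. In
    general this holds once every block has been drawn, and the previous
    result is applied after each of the countably many finite sequences of draws
    (lemma [ae_cvg]). *)

Set Implicit Arguments.
Unset Strict Implicit.
Unset Printing Implicit Defensive.

(** * Euclidean vectors and limits of sequences *)

Section Vectors.
Context {R : realType}.
Implicit Types N M : nat.

Lemma dotE N (u v : 'cV[R]_N) : dot u v = \sum_a u a 0 * v a 0.
Proof. by rewrite /dot mxE; apply: eq_bigr => a _; rewrite mxE. Qed.

Lemma dotC N (u v : 'cV[R]_N) : dot u v = dot v u.
Proof. by rewrite !dotE; apply: eq_bigr => a _; rewrite mulrC. Qed.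

Lemma dotDl N (u v w : 'cV[R]_N) : dot (u + v) w = dot u w + dot v w.
Proof. by rewrite /dot linearD /= mulmxDl mxE. Qed.

Lemma dotDr N (u v w : 'cV[R]_N) : dot u (v + w) = dot u v + dot u w.
Proof. by rewrite /dot mulmxDr mxE. Qed.

Lemma dotZl N c (u v : 'cV[R]_N) : dot (c *: u) v = c * dot u v.
Proof. by rewrite /dot linearZ /= -scalemxAl mxE. Qed.

Lemma dotZr N c (u v : 'cV[R]_N) : dot u (c *: v) = c * dot u v.
Proof. by rewrite dotC dotZl dotC. Qed.

Lemma dotNl N (u v : 'cV[R]_N) : dot (- u) v = - dot u v.
Proof. by rewrite -scaleN1r dotZl mulN1r. Qed.

Lemma dotNr N (u v : 'cV[R]_N) : dot u (- v) = - dot u v.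
Proof. by rewrite dotC dotNl dotC. Qed.

Lemma dot0l N (u : 'cV[R]_N) : dot 0 u = 0.
Proof. by rewrite -(scale0r 0) dotZl mul0r. Qed.

Lemma dot0r N (u : 'cV[R]_N) : dot u 0 = 0.
Proof. by rewrite dotC dot0l. Qed.

Definition dotB := (dotDl, dotDr, dotNl, dotNr).

Lemma dot_ge0 N (u : 'cV[R]_N) : 0 <= dot u u.
Proof. by rewrite dotE sumr_ge0 // => a _; rewrite -expr2 sqr_ge0. Qed.

Lemma dot_entry N (u : 'cV[R]_N) a : u a 0 ^+ 2 <= dot u u.
Proof.
rewrite dotE (bigD1 a) //= -expr2 lerDl sumr_ge0 // => b _.
by rewrite -expr2 sqr_ge0.
Qed.

Lemma dot_eq0 N (u : 'cV[R]_N) : dot u u = 0 -> u = 0.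
Proof.
move=> u0; apply/colP => a; rewrite mxE; apply/eqP; rewrite -sqrf_eq0.
by apply/eqP/le_anti; rewrite -{1}u0 dot_entry sqr_ge0.
Qed.

Lemma enorm_ge0 N (u : 'cV[R]_N) : 0 <= enorm u.
Proof. exact: sqrtr_ge0. Qed.

Lemma enorm_sqr N (u : 'cV[R]_N) : enorm u ^+ 2 = dot u u.
Proof. by rewrite sqr_sqrtr // dot_ge0. Qed.

Lemma dot_mulmxl N M (A : 'M[R]_(M, N)) u v : dot (A *m u) v = dot u (A^T *m v).
Proof. by rewrite /dot trmx_mul mulmxA. Qed.

Lemma dot_delta N (u : 'cV[R]_N) a : dot u (delta_mx a 0) = u a 0.
Proof.
rewrite dotE (bigD1 a) //= mxE !eqxx mulr1 big1 ?addr0 // => b ba.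
by rewrite mxE (negbTE ba) mulr0.
Qed.

Lemma dot_parallelogram N (u v : 'cV[R]_N) :
  dot (u + v) (u + v) <= 2 * dot u u + 2 * dot v v.
Proof.
have := dot_ge0 (u - v); rewrite !dotB (dotC v u); lra.
Qed.

(** The supremum that defines [opnorm] is over a bounded set, because each
    entry of [B *m u] is at most the sum of the entries of [B] in absolute value. *)
Lemma opnorm_bound N M (B : 'M[R]_(M, N)) u :
  dot (B *m u) (B *m u) <= opnorm B ^+ 2 * dot u u.
Proof.
have [->|u0] := eqVneq u 0; first by rewrite mulmx0 !dot0l mulr0.
have nu : 0 < enorm u.
  rewrite lt_neqAle enorm_ge0 andbT eq_sym; apply: contra u0 => /eqP nu.
  by apply/eqP/dot_eq0; rewrite -enorm_sqr nu expr0n.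
pose S := [set enorm (B *m u) | u in [set u : 'cV[R]_N | enorm u <= 1]].
have ubS : has_sup S.
  split; first by exists (enorm (B *m 0)); exists 0 => //=; rewrite /enorm dot0l sqrtr0.
  exists (Num.sqrt (\sum_a (\sum_b `|B a b|) ^+ 2)) => _ [v /= v1 <-].
  rewrite ler_sqrt; last by rewrite sumr_ge0 // => a _; rewrite sqr_ge0.
  rewrite dotE ler_sum // => a _; rewrite -expr2 -real_normK ?num_real //.
  rewrite ler_sqr ?nnegrE //; last by rewrite sumr_ge0.
  rewrite mxE (le_trans (ler_norm_sum _ _ _)) // ler_sum // => b _.
  rewrite normrM ler_piMr //.
  rewrite -(@ler_pXn2r _ 2%N) ?nnegrE // real_normK ?num_real //.
  rewrite (le_trans (dot_entry _ _)) // -enorm_sqr expr1n.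
  by rewrite -(expr1n _ 2) ler_sqr ?nnegrE ?enorm_ge0.
have : S (enorm (B *m ((enorm u)^-1 *: u))).
  exists ((enorm u)^-1 *: u) => //=.
  rewrite -(@ler_pXn2r _ 2%N) ?nnegrE ?enorm_ge0 // enorm_sqr dotZl dotZr -enorm_sqr.
  by rewrite expr1n mulrA -expr2 -exprMn mulVf ?expr1n ?gt_eqF.
move=> /(sup_upper_bound ubS); rewrite -/(opnorm B).
rewrite -(@ler_pXn2r _ 2%N) ?nnegrE ?enorm_ge0 //; last first.
  apply: le_trans (sup_upper_bound ubS _); first exact: (enorm_ge0 (B *m 0)).
  by exists 0 => //=; rewrite /enorm dot0l sqrtr0.
rewrite enorm_sqr -scalemxAr dotZl dotZr mulrA -expr2 exprVn mulrC.
by rewrite ler_pdivrMr ?exprn_gt0 // enorm_sqr.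
Qed.

Lemma cvg_bigsum (T I : Type) (F : set_system T) {FF : Filter F} (r : seq I)
    (u : T -> I -> R) (l : I -> R) :
  (forall i, (fun k => u k i) @ F --> l i) ->
  (fun k => \sum_(i <- r) u k i) @ F --> \sum_(i <- r) l i.
Proof.
move=> ul; elim: r => [|i r IH].
  by under eq_fun do rewrite big_nil; rewrite big_nil; exact: cvg_cst.
under eq_fun do rewrite big_cons; rewrite big_cons.
by apply: cvgD => //; exact: ul.
Qed.

Lemma cvg_colP N (u : nat -> 'cV[R]_N) (l : 'cV[R]_N) :
  (u @ \oo --> l) <-> (forall a, (fun k => u k a 0) @ \oo --> l a 0).
Proof.
split=> [ul a|ul].
  exact: cvg_comp ul (@coord_continuous R N 1 a 0 l).
apply/cvg_mx_entourageP => E entE.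
have : forall a, \forall k \near \oo, (l a 0, u k a 0) \in E.
  move=> a; have /cvg_app_entourageP/(_ E entE) := ul a.
  by apply: filterS => k; rewrite inE.
move=> /filter_forall; apply: filterS => k h a b.
by rewrite (ord1 b); exact: h.
Qed.

Lemma cvg_bigsum0 (T I : Type) (F : set_system T) {FF : Filter F} (r : seq I)
    (u : T -> I -> R) :
  (forall i, (fun k => u k i) @ F --> 0) ->
  (fun k => \sum_(i <- r) u k i) @ F --> 0.
Proof. by move=> /(cvg_bigsum (r := r)) h; rewrite big1_eq in h. Qed.

Lemma cvg0_le (u v : nat -> R) (c : R) : 0 < c -> (forall k, 0 <= u k) ->
  (forall k, c * u k <= v k) -> v @ \oo --> 0 -> u @ \oo --> 0.
Proof.
move=> c0 u0 uv v0.
apply: (@squeeze_cvgr _ _ _ _ (fun=> 0) (fun k => c^-1 * v k)).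
- by apply: nearW => k; rewrite u0 /= -ler_pdivrMl ?invr_gt0 // invrK.
- exact: cvg_cst.
- by rewrite -(mulr0 c^-1); apply: cvgM => //; exact: cvg_cst.
Qed.

Lemma cvgn_of_summable (u v : nat -> R) : (forall k, 0 <= u k) -> (forall k, 0 <= v k) ->
  cvgn (fun k => u k + \sum_(l < k) v l) -> cvgn u /\ v @ \oo --> 0.
Proof.
move=> u0 v0 cv; have [M [_ HM]] := cvg_seq_bounded cv.
have cs : cvgn (fun k => \sum_(l < k) v l).
  apply: nondecreasing_is_cvgn.
    by apply/nondecreasing_seqP => k; rewrite big_ord_recr /= lerDl.
  exists (M + 1) => _ [k _ <-].
  apply: (@le_trans _ _ (u k + \sum_(l < k) v l)); first by rewrite lerDr.
  by apply: le_trans (ler_norm _) _; apply: (HM (M + 1)) => //; rewrite ltrDl.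
split.
  have -> : u = (fun k => (u k + \sum_(l < k) v l) - \sum_(l < k) v l).
    by apply/funext => k; rewrite addrK.
  exact: is_cvgB.
apply: cvg_series_cvg_0; rewrite /series /=.
by under eq_fun do rewrite big_mkord.
Qed.

Lemma dot_continuousl N (u y : 'cV[R]_N) :
  (fun y' => dot y' u) @ nbhs y --> dot y u.
Proof.
rewrite (funext (fun y' => dotE y' u)) dotE.
apply: (@cvg_bigsum _ _ (nbhs y)) => i.
by apply: cvgM; [exact: coord_continuous|exact: cvg_cst].
Qed.

Lemma cvg_dot N (u v : nat -> 'cV[R]_N) a b : u @ \oo --> a -> v @ \oo --> b ->
  (fun k => dot (u k) (v k)) @ \oo --> dot a b.
Proof.
move=> /cvg_colP ua /cvg_colP vb; rewrite dotE; under eq_fun do rewrite dotE.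
apply: cvg_bigsum => i; apply: cvgM; [exact: ua|exact: vb].
Qed.

Lemma cvg_mulmx N M (A : 'M[R]_(M, N)) (u : nat -> 'cV[R]_N) a : u @ \oo --> a ->
  (fun k => A *m u k) @ \oo --> A *m a.
Proof.
move=> /cvg_colP ua; apply/cvg_colP => i; rewrite mxE; under eq_fun do rewrite mxE.
by apply: cvg_bigsum => j; apply: cvgM; [exact: cvg_cst|exact: ua].
Qed.

Lemma cvg_dot0 N (u : nat -> 'cV[R]_N) (l : 'cV[R]_N) :
  (fun k => dot (u k - l) (u k - l)) @ \oo --> 0 -> u @ \oo --> l.
Proof.
move=> ul; apply/cvg_colP => a; apply/subr_cvg0.
have : (fun k => (u k a 0 - l a 0) ^+ 2) @ \oo --> 0.
  apply: (@squeeze_cvgr _ _ _ _ (fun=> 0) (fun k => dot (u k - l) (u k - l)));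
    [|exact: cvg_cst|exact: ul].
  by near=> k; rewrite sqr_ge0 (le_trans _ (dot_entry _ a)) // !mxE.
move=> /cvgrPdist_lt h; apply/cvgrPdist_lt => eps e0.
have := h (eps ^+ 2) (exprn_gt0 _ e0).
apply: filterS => k; rewrite !sub0r !normrN normrX ltr_pXn2r ?nnegrE //; exact: ltW.
Unshelve. all: by end_near. Qed.

(** Subsequences are indexed by maps [phi] with [j <= phi j] rather than by
    increasing ones: limits need no more, and such maps compose. *)
Lemma cvg_reindex (U : topologicalType) (u : nat -> U) (l : U) (phi : nat -> nat) :
  (forall j, (j <= phi j)%N) -> u @ \oo --> l -> (u \o phi) @ \oo --> l.
Proof.
move=> jphi ul; apply: cvg_comp ul => A [K _ KA].
by exists K => // j /= Kj; apply: KA => /=; exact: leq_trans Kj (jphi j).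
Qed.

(** Bolzano-Weierstrass, from the compactness of a cube of row vectors. *)
Lemma bounded_subseq N (u : nat -> 'cV[R]_N) (C : R) :
  (forall k, dot (u k) (u k) <= C) ->
  exists l : 'cV[R]_N, exists2 phi : nat -> nat, (forall j, (j <= phi j)%N)
    & (u \o phi) @ \oo --> l.
Proof.
move=> uC; have C0 : 0 <= C by exact: le_trans (dot_ge0 _) (uC 0%N).
pose c := Num.sqrt C.
pose K := [set v : 'rV[R]_N | forall i, `[- c, c]%classic (v ord0 i)].
have Kc : compact K.
  by apply: (@rV_compact R N (fun=> `[- c, c]%classic)) => _; exact: segment_compact.
have uK k : K (u k)^T.
  move=> a /=; rewrite mxE in_itv /= -ler_norml -sqrtr_sqr ler_sqrt //.
  exact: le_trans (dot_entry _ _) (uC k).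
have [l [_ cl]] : K `&` cluster ((fun k => (u k)^T) @ \oo) !=set0.
  apply: Kc; exists 0%N => // k _; exact: uK.
have ex j : exists k, (j <= k)%N /\ `|l - (u k)^T| < j.+1%:R^-1.
  have [] := cl [set (u k)^T | k in [set k | (j <= k)%N]] (ball l j.+1%:R^-1).
  - by exists j => // k /= jk; exists k.
  - by apply: nbhsx_ballx; rewrite invr_gt0.
  by move=> _ [[k /= jk <-]]; rewrite -ball_normE /= => h; exists k.
have [phi hphi] := choice ex.
exists l^T; exists phi; first by move=> j; have [] := hphi j.
apply/cvg_colP => a.
apply/cvgrPdist_lt => eps e0; near=> j.
have [_ h] := hphi j; rewrite mxE /=.
apply: (@le_lt_trans _ _ `|l - (u (phi j))^T|).
  have -> : l ord0 a - u (phi j) a 0 = (l - (u (phi j))^T) ord0 a by rewrite !mxE.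
  rewrite [leRHS]/Num.Def.normr /= mx_normrE.
  by apply/bigmax_geP; right; exists (ord0, a).
apply: lt_trans h _; near: j.
have /cvgrPdist_lt/(_ _ e0) := @cvg_harmonic R.
by apply: filterS => k; rewrite sub0r normrN /harmonic ger0_norm ?invr_ge0.
Unshelve. all: by end_near. Qed.

Lemma rat_dense N (u : 'cV[R]_N) (eps : R) : 0 < eps ->
  exists q : 'cV[rat]_N, dot (u - map_mx ratr q) (u - map_mx ratr q) < eps.
Proof.
move=> e0; pose eta := Num.min 1 (eps / N.+1%:R).
have eta0 : 0 < eta by rewrite lt_min ltr01 divr_gt0.
have ex a : exists q : rat, `|u a 0 - ratr q| < eta.
  have [|q] := @rat_in_itvoo R (u a 0 - eta) (u a 0 + eta); first lra.
  rewrite in_itv /= => /andP[q1 q2]; exists q; rewrite ltr_norml; lra.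
have [q hq] := choice ex; exists (\col_a q a); rewrite dotE.
apply: (@le_lt_trans _ _ (\sum_(a < N) eta)).
  apply: ler_sum => a _; rewrite !mxE -expr2 -real_normK ?num_real //.
  apply: (@le_trans _ _ (eta ^+ 2)); first by rewrite ler_pXn2r ?nnegrE // ltW.
  by rewrite expr2 ger_pMr // ge_min lexx.
rewrite sumr_const card_ord -mulr_natr.
apply: (@le_lt_trans _ _ (eps / N.+1%:R * N%:R)).
  by rewrite ler_wpM2r // ge_min lexx orbT.
by rewrite mulrAC ltr_pdivrMr // ltr_pM2l // ltr_nat.
Qed.

Lemma dot_subC N (u v : 'cV[R]_N) : dot (u - v) (u - v) = dot (v - u) (v - u).
Proof. by rewrite -(opprB v u) dotNl dotNr opprK. Qed.

(** For each rational point and each precision, pick a point of [S] that close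
    whenever there is one. *)
Lemma countable_dense N M (S : set ('cV[R]_N * 'cV[R]_M)) : S !=set0 ->
  exists c : 'cV[rat]_N * 'cV[rat]_M * nat -> 'cV[R]_N * 'cV[R]_M,
    (forall q, S (c q)) /\
    forall z eps, S z -> 0 < eps -> exists q,
      dot (z.1 - (c q).1) (z.1 - (c q).1) + dot (z.2 - (c q).2) (z.2 - (c q).2) < eps.
Proof.
move=> [z0 Sz0].
pose near (q : 'cV[rat]_N * 'cV[rat]_M * nat) (z : 'cV[R]_N * 'cV[R]_M) :=
  dot (z.1 - map_mx ratr q.1.1) (z.1 - map_mx ratr q.1.1) +
  dot (z.2 - map_mx ratr q.1.2) (z.2 - map_mx ratr q.1.2) < q.2.+1%:R^-1.
pose c q := xget z0 [set z | S z /\ near q z].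
exists c; split=> [q|z eps Sz e0].
  by rewrite /c; case: xgetP => [z _ []|].
pose r := Num.truncn (4 / eps).
have r0 : 0 < (r.+1%:R : R)^-1 / 2 by rewrite divr_gt0 // invr_gt0.
have [q1 hq1] := rat_dense z.1 r0; have [q2 hq2] := rat_dense z.2 r0.
exists (q1, q2, r); have zn : near (q1, q2, r) z by rewrite /near /= [ltRHS]splitr ltrD.
have : near (q1, q2, r) (c (q1, q2, r)).
  rewrite /c; case: xgetP => [z' _ [] //|no]; by case: (no z).
move: zn; rewrite /near /=; set z' := c _.
have := dot_parallelogram (z.1 - map_mx ratr q1) (map_mx ratr q1 - z'.1).
have := dot_parallelogram (z.2 - map_mx ratr q2) (map_mx ratr q2 - z'.2).
rewrite !addrA !subrK (dot_subC (map_mx _ _) z'.1) (dot_subC (map_mx _ _) z'.2).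
have : 4 * r.+1%:R^-1 < eps.
  by rewrite ltr_pdivrMr // mulrC -ltr_pdivrMr // truncnS_gt.
move: (r.+1%:R^-1 : R) => rr; lra.
Qed.

End Vectors.

(** * Convex functions, subgradients and proximal points *)

Section Convex.
Context {R : realType} {N : nat}.
Implicit Types (phi : 'cV[R]_N -> \bar R).

Lemma proper_fine phi x : eproper phi -> edom phi x -> phi x = (fine (phi x))%:E.
Proof.
move=> [pm _] px; rewrite fineK // fin_numE pm /=.
by rewrite lt_eqF.
Qed.

(** The form in which semicontinuity is used along sequences. *)
Lemma lsc_cvg_le phi (u : nat -> 'cV[R]_N) (l : 'cV[R]_N) (c : nat -> R) (c0 : R) :
  lower_semicontinuous phi -> u @ \oo --> l -> c @ \oo --> c0 ->
  (forall k, (phi (u k) <= (c k)%:E)%E) -> (phi l <= c0%:E)%E.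
Proof.
move=> lsc ul cc0 uc; apply/lee_addgt0Pr => eps e0; rewrite leNgt; apply/negP => lt.
have [V Vl Vphi] := lsc _ _ lt.
have : \forall k \near \oo, False.
  near=> k.
  have /Vphi : V (u k) by near: k; exact: ul.
  apply/negP; rewrite -leNgt (le_trans (uc k)) // lee_fin ltW //.
  near: k; apply: (cvgr_lt c0) => //; by rewrite ltrDl.
by move=> [K _ /(_ K)]; apply; rewrite /=.
Unshelve. all: by end_near. Qed.

Lemma econvex_fin phi x y a b t : econvex phi -> phi x = a%:E -> phi y = b%:E ->
  0 <= t <= 1 -> (phi (t *: x + (1 - t) *: y)%R <= (t * a + (1 - t) * b)%:E)%E.
Proof. by move=> cvx xa yb t01; have := cvx x y t t01; rewrite xa yb. Qed.

(** Semicontinuity bounds [phi] below on a compact ball, and convexity along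
    the rays issued from its centre turns this bound into a linear one. *)
Lemma convex_minorant phi : proper_lsc_convex phi ->
  exists x0 a b, 0 <= b /\ forall u, ((- a - b * enorm (u - x0))%:E <= phi u)%E.
Proof.
move=> [pphi lsc cvx]; have [pm [x0 x0dom]] := pphi.
have phi0 := proper_fine pphi x0dom; set c := fine (phi x0) in phi0.
have [m hm] : exists m : nat, forall u, dot (u - x0) (u - x0) <= 1 ->
    ((- m%:R)%:E <= phi u)%E.
  (* Otherwise some points of the ball have values tending to [-oo], and by
     semicontinuity the value at a cluster point is below every integer. *)
  apply/not_existsP => /= no.
  have ex m : exists u, dot (u - x0) (u - x0) <= 1 /\ (phi u <= (- m%:R)%:E)%E.
    have /existsNP[u /not_implyP[u1 /negP]] := no m; rewrite -ltNge => /ltW u2.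
    by exists u.
  have [u hu] := choice ex.
  have [l [phi' jphi cvl]] := bounded_subseq (u := fun m => u m - x0) (fun m => (hu m).1).
  have ul : (u \o phi') @ \oo --> l + x0.
    rewrite [X in X @ _ --> _](_ : _ = (fun m => (u (phi' m) - x0) + x0)).
      by apply: cvgD; [exact: cvl|exact: cvg_cst].
    by apply/funext => j /=; rewrite subrK.
  have le K : (phi (l + x0)%R <= (- K%:R : R)%:E)%E.
    apply: (@lsc_cvg_le _ (u \o phi' \o addn K) _ (fun=> - K%:R)) => //.
    - by apply: cvg_reindex ul => j; rewrite leq_addl.
    - exact: cvg_cst.
    - move=> j; apply: le_trans (hu _).2 _.
      rewrite lee_fin lerN2 ler_nat; exact: leq_trans (leq_addr j K) (jphi _).
  have ldom : edom phi (l + x0) by apply: le_lt_trans (le 0%N) (ltry _).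
  have lfin := proper_fine pphi ldom.
  have := le (Num.truncn `|fine (phi (l + x0))|).+1; rewrite lfin lee_fin.
  have := truncnS_gt `|fine (phi (l + x0))|.
  have := ler_norm (- fine (phi (l + x0))); rewrite normrN; lra.
exists x0, m%:R, (m%:R + `|c|); split; first by rewrite addr_ge0.
move=> u; set r := enorm (u - x0); have r0 : 0 <= r by exact: enorm_ge0.
have [r1|r1] := leP r 1.
  have : dot (u - x0) (u - x0) <= 1.
    by rewrite -enorm_sqr -(expr1n _ 2) ler_sqr ?nnegrE.
  by move=> /hm; apply: le_trans; rewrite lee_fin gerBl mulr_ge0 // addr_ge0.
have [|udom] := eqVneq (phi u) +oo%E; first by move=> ->; rewrite leey.
have {}udom : edom phi u by rewrite /edom /= lt_neqAle udom leey.
have us := proper_fine pphi udom; set s := fine (phi u) in us.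
have rp : 0 < r by exact: lt_trans r1.
have ri : 0 <= r^-1 <= 1 by rewrite invr_ge0 r0 invf_le1 // ltW.
have w1 : dot (r^-1 *: u + (1 - r^-1) *: x0 - x0) (r^-1 *: u + (1 - r^-1) *: x0 - x0) <= 1.
  have -> : r^-1 *: u + (1 - r^-1) *: x0 - x0 = r^-1 *: (u - x0).
    by apply/colP => i; rewrite !mxE; ring.
  rewrite dotZl dotZr -enorm_sqr -/r mulrA -expr2 -exprMn mulVf ?expr1n //.
  by rewrite gt_eqF.
have := le_trans (hm _ w1) (econvex_fin cvx us phi0 ri).
rewrite lee_fin us lee_fin => h.
have {}h : - m%:R * r <= s + (r - 1) * c.
  have -> : s + (r - 1) * c = (r^-1 * s + (1 - r^-1) * c) * r.
    by field; rewrite gt_eqF.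
  by rewrite ler_wpM2r.
have nc : - ((r - 1) * `|c|) <= - ((r - 1) * c).
  by rewrite lerN2 ler_wpM2l ?ler_norm // subr_ge0 ltW.
have := normr_ge0 c; have : (0 : R) <= m%:R by []; nra.
Qed.

(** The proximal subproblem has a solution: the quadratic term beats the linear
    minorant of [phi], hence minimizing sequences are bounded. *)
Lemma prox_argmin_ex phi (W : 'M[R]_N) (c : R) v : proper_lsc_convex phi ->
  0 < c -> (forall u, c * dot u u <= dot u (W *m u)) ->
  argmin (fun u => (phi u + (2^-1 * wnormsq W (u - v))%:E)%E) !=set0.
Proof.
move=> pphi c0 Wc; have [x0 [a [b [b0 minor]]]] := convex_minorant pphi.
have [proper lsc cvx] := pphi; have [pm [x1 x1dom]] := proper.
pose q u := 2^-1 * wnormsq W (u - v).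
(* Young's inequality absorbs the linear minorant in one half of the growth
   [c / 4 * dot (u - x0) (u - x0)] of the quadratic term around [x0]; [L] collects
   the constants. *)
pose L := - a - 2 * b ^+ 2 / c - c / 2 * dot (v - x0) (v - x0).
have bound u r : phi u = r%:E -> L + c / 8 * dot (u - x0) (u - x0) <= r + q u.
  move=> ur; have := minor u; rewrite ur lee_fin => h1.
  have h2 := Wc (u - v).
  have h3 := dot_parallelogram (u - v) (v - x0); rewrite addrA subrK in h3.
  have h4 : b * enorm (u - x0) <= c / 8 * dot (u - x0) (u - x0) + 2 * b ^+ 2 / c.
    rewrite -enorm_sqr -subr_ge0.
    have -> : c / 8 * enorm (u - x0) ^+ 2 + 2 * b ^+ 2 / c - b * enorm (u - x0) =
      c / 8 * (enorm (u - x0) - 4 * b / c) ^+ 2 by field; rewrite gt_eqF.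
    by rewrite mulr_ge0 ?sqr_ge0 // divr_ge0 // ltW.
  rewrite /L /q /wnormsq; nra.
pose E := [set r : R | exists u, (phi u + (q u)%:E <= r%:E)%E].
have Einf : has_inf E.
  split.
    exists (fine (phi x1) + q x1), x1.
    by rewrite (proper_fine proper x1dom).
  exists L => r [u]; have [->|uoo] := eqVneq (phi u) +oo%E; first by [].
  rewrite (@proper_fine _ u) //; last by rewrite /edom /= lt_neqAle uoo leey.
  rewrite -EFinD lee_fin; apply: le_trans.
  apply: le_trans (bound u _ _); last first.
    by apply: proper_fine => //; rewrite /edom /= lt_neqAle uoo leey.
  by rewrite lerDl mulr_ge0 ?dot_ge0 // divr_ge0 // ltW.
set m := inf E.
have ex (j : nat) : exists u, (phi u + (q u)%:E <= (m + j.+1%:R^-1)%:E)%E.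
  have [r [u ur] rm] := @inf_adherent _ E j.+1%:R^-1 ltac:(by rewrite invr_gt0) Einf.
  by exists u; apply: le_trans ur _; rewrite lee_fin ltW.
have [u hu] := choice ex.
have ufin j : phi (u j) = (fine (phi (u j)))%:E.
  apply: proper_fine => //; rewrite /edom /=; move: (hu j).
  by case: (phi (u j)) => // r; rewrite ltry.
have uj1 (j : nat) : (j.+1%:R^-1 : R) <= 1 by rewrite invf_le1 ?ltr0n // ler1n.
have ubd j : dot (u j - x0) (u j - x0) <= 8 / c * (m + 1 - L).
  have h2 := bound _ _ (ufin j).
  have h1 := hu j; rewrite ufin -EFinD lee_fin in h1.
  have -> : dot (u j - x0) (u j - x0) = 8 / c * (c / 8 * dot (u j - x0) (u j - x0)).
    by field; rewrite gt_eqF.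
  rewrite ler_pM2l ?divr_gt0 // lerBrDl; apply: le_trans (le_trans h2 h1) _.
  by rewrite lerD2l.
have [l [s js cvl]] := bounded_subseq ubd.
have ul : (u \o s) @ \oo --> l + x0.
  rewrite [X in X @ _ --> _](_ : _ = (fun m => (u (s m) - x0) + x0)).
    by apply: cvgD; [exact: cvl|exact: cvg_cst].
  by apply/funext => j /=; rewrite subrK.
have cvq : (fun j => q (u (s j))) @ \oo --> q (l + x0).
  apply: cvgM; first exact: cvg_cst.
  have ulv : (fun j => u (s j) - v) @ \oo --> l + x0 - v.
    by apply: cvgD; [exact: ul|exact: cvg_cst].
  by apply: cvg_dot => //; exact: cvg_mulmx.
have min : (phi (l + x0)%R + (q (l + x0))%:E <= m%:E)%E.
  rewrite -leeBrDr // -EFinB.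
  apply: (@lsc_cvg_le _ (u \o s) _ (fun j => m + (s j).+1%:R^-1 - q (u (s j)))) => //.
    apply: cvgB => //; rewrite -[X in _ --> X]addr0; apply: cvgD; first exact: cvg_cst.
    exact: (cvg_reindex js (@cvg_harmonic R)).
  by move=> j; rewrite EFinB leeBrDr //; exact: hu.
exists (l + x0) => w; apply: le_trans min _; rewrite -/(q w).
have [->|woo] := eqVneq (phi w) +oo%E; first by rewrite leey.
have wfin : phi w = (fine (phi w))%:E.
  by apply: proper_fine => //; rewrite /edom /= lt_neqAle woo leey.
rewrite wfin -EFinD lee_fin; apply: ge_inf; first by case: Einf.
by exists w; rewrite wfin -EFinD.
Qed.

(** Fermat's rule, by comparing [u] with [t *: w + (1 - t) *: u] and letting [t]
    tend to 0: the quadratic term contributes its derivative only. *)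
Lemma argmin_subdiff phi (W : 'M[R]_N) v u : eproper phi -> econvex phi ->
  W^T = W -> argmin (fun u => (phi u + (2^-1 * wnormsq W (u - v))%:E)%E) u ->
  subdiff phi u (W *m (v - u)).
Proof.
move=> proper cvx sW umin; have [pm [x1 x1dom]] := proper.
have udom : edom phi u.
  have := umin x1; rewrite (proper_fine proper x1dom) /edom /=.
  by case: (phi u) => // r; rewrite ltry.
have ufin := proper_fine proper udom; set a := fine _ in ufin.
move=> w; have [->|woo] := eqVneq (phi w) +oo%E; first by rewrite leey.
have wdom : edom phi w by rewrite /edom /= lt_neqAle woo leey.
have wfin := proper_fine proper wdom; set b := fine _ in wfin.
rewrite wfin ufin -EFinD lee_fin.
set qw := dot (w - u) (W *m (w - u)).
have key (t : R) : 0 < t <= 1 -> a + dot (W *m (v - u)) (w - u) <= b + t * (2^-1 * qw).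
  move=> /andP[t0 t1]; have t01 : 0 <= t <= 1 by rewrite ltW.
  have := umin (t *: w + (1 - t) *: u).
  rewrite -leeBlDr // => /le_trans/(_ (econvex_fin cvx wfin ufin t01)).
  rewrite ufin -EFinD lee_fin /wnormsq.
  have -> : t *: w + (1 - t) *: u - v = (u - v) + t *: (w - u).
    by apply/colP => i; rewrite !mxE; ring.
  have sWd x y : dot x (W *m y) = dot y (W *m x).
    by rewrite dotC dot_mulmxl sW.
  have -> : v - u = - (u - v) by rewrite opprB.
  rewrite /qw; move: (u - v) (w - u) => d1 d2.
  rewrite mulmxDr -scalemxAr !(dotDl, dotDr, dotZl, dotZr).
  rewrite (sWd d2 d1) dot_mulmxl sW dotNl => h.
  rewrite -(ler_pM2l t0); lra.
apply/ler_addgt0Pr => eps e0.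
pose t := Num.min 1 (eps / (`|2^-1 * qw| + 1)).
have dp : 0 < `|2^-1 * qw| + 1 by rewrite ltr_pwDr.
have t0 : 0 < t by rewrite lt_min ltr01 divr_gt0.
have t1 : 0 < t <= 1 by rewrite t0 ge_min lexx.
apply: le_trans (key t t1) _; rewrite lerD2l.
apply: (@le_trans _ _ (t * (`|2^-1 * qw| + 1))).
  by rewrite ler_pM2l // (le_trans (ler_norm _)) // lerDl.
by rewrite -ler_pdivlMr // ge_min lexx orbT.
Qed.

Lemma prox_subdiff phi (V : 'M[R]_N) (c : R) v : proper_lsc_convex phi ->
  (invmx V)^T = invmx V -> 0 < c ->
  (forall u, c * dot u u <= dot u (invmx V *m u)) ->
  subdiff phi (prox V phi v) (invmx V *m (v - prox V phi v)).
Proof.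
move=> pphi sV c0 Vc; have [proper _ cvx] := pphi.
apply: argmin_subdiff => //; rewrite /prox.
have [u hu] := prox_argmin_ex v pphi c0 Vc.
exact: xgetI hu.
Qed.

Lemma subdiff_fin phi x v : eproper phi -> subdiff phi x v ->
  phi x = (fine (phi x))%:E.
Proof.
move=> proper sub; apply: proper_fine => //; have [_ [w wdom]] := proper.
have := sub w; rewrite (proper_fine proper wdom) /edom /=.
by case: (phi x) => // r; rewrite ltry.
Qed.

Lemma subdiff_le phi x v w : eproper phi -> subdiff phi x v -> edom phi w ->
  fine (phi x) + dot v (w - x) <= fine (phi w).
Proof.
move=> proper sub wdom; have := sub w.
by rewrite (subdiff_fin proper sub) (proper_fine proper wdom) -EFinD lee_fin.
Qed.

Lemma subdiff_closed phi (u v : nat -> 'cV[R]_N) (l s : 'cV[R]_N) :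
  eproper phi -> lower_semicontinuous phi -> u @ \oo --> l -> v @ \oo --> s ->
  (forall k, subdiff phi (u k) (v k)) -> subdiff phi l s.
Proof.
move=> proper lsc ul vs sub w.
have [->|woo] := eqVneq (phi w) +oo%E; first by rewrite leey.
have wdom : edom phi w by rewrite /edom /= lt_neqAle woo leey.
rewrite (proper_fine proper wdom) -leeBrDr // -EFinB.
apply: (@lsc_cvg_le _ u _ (fun k => fine (phi w) - dot (v k) (w - u k))) => //.
  apply: cvgB; first exact: cvg_cst.
  by apply: cvg_dot => //; apply: cvgB => //; exact: cvg_cst.
by move=> k; rewrite EFinB leeBrDr // -(proper_fine proper wdom) //; exact: sub.
Qed.

(** That the conjugate is finite somewhere is the existence of an affine minorant
    of [phi]; the proximal point of 0 provides one. *)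
Lemma conjugate_proper_lsc_convex phi : proper_lsc_convex phi ->
  proper_lsc_convex (conjugate phi).
Proof.
move=> pphi; have [proper lsc cvx] := pphi; have [pm [x0 x0dom]] := proper.
have x0fin := proper_fine proper x0dom.
have ub y u : ((dot y u)%:E - phi u <= conjugate phi y)%E.
  by apply: ereal_sup_ubound; exists u.
split; [split| |].
- move=> y; rewrite -ltNye; apply: lt_le_trans (ub y x0).
  by rewrite x0fin -EFinB ltNyr.
- have := @prox_subdiff phi 1%:M 1 0 pphi; rewrite invmx1 trmx1.
  move=> /(_ erefl ltr01 (fun u => _)); rewrite !mul1mx sub0r; set u := prox _ _ _ => h.
  have sub : subdiff phi u (- u) by apply: h => w; rewrite mul1r mul1mx.
  exists (- u); rewrite /edom /=.
  apply: (@le_lt_trans _ _ (dot (- u) u - fine (phi u))%:E); last exact: ltry.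
  apply: ge_ereal_sup => _ [w _ <-]; have := sub w.
  rewrite (subdiff_fin proper sub); case: (phi w) (pm w) => [r| |] //= _.
    by rewrite -EFinD -EFinB !lee_fin dotDr (dotNr (- u) u); lra.
  by move=> _; exact: leNye.
- move=> y a /ereal_sup_gt [_ [u _ <-]].
  have [->|uoo] := eqVneq (phi u) +oo%E; first by [].
  have udom : edom phi u by rewrite /edom /= lt_neqAle uoo leey.
  have ufin := proper_fine proper udom; rewrite ufin -EFinB lte_fin => lt.
  exists [set y' | a < dot y' u - fine (phi u)].
    have cont : (fun y' => dot y' u - fine (phi u)) @ nbhs y --> dot y u - fine (phi u).
      by apply: cvgB; [exact: dot_continuousl|exact: cvg_cst].
    exact: (cvgr_gt _ cont _ lt).
  move=> y' /= lt'; apply: lt_le_trans (ub y' u).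
  by rewrite ufin -EFinB lte_fin.
- move=> y y' t /andP[t0 t1]; apply: ge_ereal_sup => _ [u _ <-].
  have [->|uoo] := eqVneq (phi u) +oo%E; first by rewrite leNye.
  have udom : edom phi u by rewrite /edom /= lt_neqAle uoo leey.
  have ufin := proper_fine proper udom; rewrite ufin -EFinB.
  have -> : (dot (t *: y + (1 - t) *: y') u - fine (phi u))%:E =
     (t%:E * (dot y u - fine (phi u))%:E + (1 - t)%:E * (dot y' u - fine (phi u))%:E)%E.
    rewrite -!EFinM -EFinD dotDl !dotZl; congr EFin; ring.
  apply: leeD; apply: lee_wpmul2l; rewrite ?lee_fin ?subr_ge0 //.
    by have := ub y u; rewrite ufin.
  by have := ub y' u; rewrite ufin.
Qed.

End Convex.

(** * Gradients of convex functions *)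

Section Gradient.
Context {R : realType} {N : nat} (f : 'cV[R]_N -> R).
Hypothesis fcvx : econvex (fun x => (f x)%:E).
Hypothesis fdiff : forall x, differentiable f x.

Lemma grad_dot x v : dot (grad f x) v = 'D_v f x.
Proof.
have vE : v = \sum_a v a 0 *: delta_mx a 0.
  rewrite {1}(matrix_sum_delta v); apply: eq_bigr => a _.
  by rewrite big_ord1.
rewrite deriveE // [in RHS]vE linear_sum dotE; apply: eq_bigr => a _.
by rewrite mxE linearZ /= deriveE // mulrC.
Qed.

Lemma grad_diff_quotient x v :
  (fun j : nat => j.+1%:R * (f (x + j.+1%:R^-1 *: v) - f x)) @ \oo
    --> dot (grad f x) v.
Proof.
rewrite grad_dot.
have /cvg_ex[l hl] : derivable f x v by exact: diff_derivable.
rewrite /derive (cvg_lim _ hl) //.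
have h0 : (fun j : nat => (j.+1%:R^-1 : R)) @ \oo --> (0 : R)^'.
  move=> A A0; have := @cvg_harmonic R _ A0.
  move=> [K _ KA]; exists K => // j /KA /=.
  by apply; apply: lt0r_neq0; exact: harmonic_gt0.
have := cvg_comp _ _ h0 hl; apply: cvg_trans.
apply: near_eq_cvg; apply: nearW => j /=.
by rewrite invrK (addrC x).
Qed.

Lemma convex_grad x w : f x + dot (grad f x) (w - x) <= f w.
Proof.
rewrite -lerBrDl.
apply: (cvgr_to_le (@grad_diff_quotient x (w - x))); apply: nearW => j.
have t01 : 0 <= (j.+1%:R^-1 : R) <= 1.
  by rewrite invr_ge0 ler0n /= invf_le1 ?ltr0n // ler1n.
have := econvex_fin fcvx (erefl (f w)%:E) (erefl (f x)%:E) t01; rewrite lee_fin.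
have -> : j.+1%:R^-1 *: w + (1 - j.+1%:R^-1) *: x = x + j.+1%:R^-1 *: (w - x).
  by apply/colP => i; rewrite !mxE; ring.
move=> h; have -> : f w - f x = j.+1%:R * (j.+1%:R^-1 * f w + (1 - j.+1%:R^-1) * f x - f x).
  have : (j.+1%:R : R) != 0 by rewrite pnatr_eq0.
  by move: (j.+1%:R : R) => c c0; field.
by rewrite ler_pM2l // lerD2r.
Qed.

(** Difference quotients of a convex function majorize its directional
    derivatives uniformly in the base point, whence the semicontinuity of
    [x |-> 'D_v f x]; applied to [v] and [- v] it gives continuity. *)
Lemma grad_usc (u : nat -> 'cV[R]_N) (l : 'cV[R]_N) v eps : u @ \oo --> l -> 0 < eps ->
  \forall k \near \oo, dot (grad f (u k)) v < dot (grad f l) v + eps.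
Proof.
move=> ul e0.
have [j hj] : exists j : nat, j.+1%:R * (f (l + j.+1%:R^-1 *: v) - f l) < dot (grad f l) v + eps.
  have := cvgr_lt _ (@grad_diff_quotient l v) (dot (grad f l) v + eps) ltac:(by rewrite ltrDl).
  by move=> [K _ /(_ K (leqnn K))]; exists K.
have fcont x0 (s : nat -> 'cV[R]_N) : s @ \oo --> x0 -> (fun k => f (s k)) @ \oo --> f x0.
  by move=> sx; apply: cvg_comp sx _; exact: differentiable_continuous (fdiff x0).
have cv : (fun k => j.+1%:R * (f (u k + j.+1%:R^-1 *: v) - f (u k))) @ \oo
    --> j.+1%:R * (f (l + j.+1%:R^-1 *: v) - f l).
  apply: cvgM; first exact: cvg_cst.
  apply: cvgB; last exact: fcont.
  by apply: fcont; apply: cvgD => //; exact: cvg_cst.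
have [K _ HK] := cvgr_lt _ cv _ hj; exists K => // k /HK /=; apply: le_lt_trans.
have := convex_grad (u k) (u k + j.+1%:R^-1 *: v).
rewrite addrAC subrr add0r dotZr -lerBrDl => h.
rewrite -(ler_pM2l (x := j.+1%:R^-1)) ?invr_gt0 //.
by rewrite [leRHS]mulrA mulVf ?pnatr_eq0 // mul1r.
Qed.

Lemma grad_cvg (u : nat -> 'cV[R]_N) (l : 'cV[R]_N) : u @ \oo --> l ->
  (fun k => grad f (u k)) @ \oo --> grad f l.
Proof.
move=> ul; apply/cvg_colP => a; apply/cvgrPdist_lt => eps e0.
have h1 := grad_usc (delta_mx a 0) ul e0.
have h2 := grad_usc (- delta_mx a 0) ul e0.
near=> k; rewrite ltr_norml -!dot_delta.
have : dot (grad f (u k)) (delta_mx a 0) < dot (grad f l) (delta_mx a 0) + eps.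
  by near: k.
have : dot (grad f (u k)) (- delta_mx a 0) < dot (grad f l) (- delta_mx a 0) + eps.
  by near: k.
rewrite !dotNr; lra.
Unshelve. all: by end_near. Qed.

End Gradient.

(** * Block vectors and separable functions *)

Section Blocks.
Context {R : realType} {n : nat} {d : 'I_n -> nat}.
Implicit Types (u v : bvec R d).

Lemma dot_blocks u v : dot u v = \sum_i dot (submxcol u i) (submxcol v i).
Proof.
rewrite -{1}[u]submxcolK -{1}[v]submxcolK /dot tr_mxcol mul_mxrow_mxcol summxE.
by [].
Qed.

Lemma submxcol_Ublock i (w : 'cV[R]_(d i)) : submxcol (Ublock w) i = w.
Proof. by rewrite /Ublock mxcolK dfwithin. Qed.

Lemma submxcol_Ublock_neq i (w : 'cV[R]_(d i)) l : i != l ->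
  submxcol (Ublock w) l = 0.
Proof. by move=> il; rewrite /Ublock mxcolK dfwithout. Qed.

Lemma dot_Ublock u i (w : 'cV[R]_(d i)) : dot u (Ublock w) = dot (submxcol u i) w.
Proof.
rewrite dot_blocks (bigD1 i) //= submxcol_Ublock big1 ?addr0 // => l li.
by rewrite submxcol_Ublock_neq 1?eq_sym // dot0r.
Qed.

Lemma blockdiag_mul (s : 'I_n -> R) u i :
  submxcol (blockdiag d s *m u) i = s i *: submxcol u i.
Proof.
rewrite -{1}[u]submxcolK /blockdiag mul_mxdiag_mxcol mxcolK.
by rewrite mul_scalar_mx.
Qed.

Lemma mulmx_ext N M (A B : 'M[R]_(N, M)) :
  (forall u : 'cV[R]_M, A *m u = B *m u) -> A = B.
Proof.
move=> AB; apply/matrixP => i j; have := AB (delta_mx j 0).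
by rewrite -!colE => /colP/(_ i); rewrite !mxE.
Qed.

Lemma blockdiag_inv (s : 'I_n -> R) : (forall i, 0 < s i) ->
  invmx (blockdiag d s) = blockdiag d (fun i => (s i)^-1).
Proof.
move=> s0.
have sV : blockdiag d s *m blockdiag d (fun i => (s i)^-1) = 1%:M.
  apply: mulmx_ext => u; rewrite mul1mx -mulmxA; apply/mxcolP => i.
  by rewrite !blockdiag_mul scalerA mulfV ?scale1r // gt_eqF.
have [su _] := mulmx1_unit sV.
by rewrite -[RHS]mul1mx -(mulVmx su) -mulmxA sV mulmx1.
Qed.

Lemma blockdiag_tr (s : 'I_n -> R) : (blockdiag d s)^T = blockdiag d s.
Proof. by rewrite /blockdiag tr_mxdiag; apply: eq_mxdiag => i; rewrite tr_scalar_mx. Qed.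

Lemma pmin_gt0 (s : 'I_n -> R) : (forall i, 0 < s i) -> 0 < pmin s.
Proof. by move=> s0; rewrite /pmin; apply/bigmin_gtP; split. Qed.

Lemma pmin_le (s : 'I_n -> R) i : pmin s <= s i.
Proof. exact: bigmin_le_cond. Qed.

Lemma wnormsq_blockdiag (s : 'I_n -> R) u :
  wnormsq (blockdiag d s) u = \sum_i s i * dot (submxcol u i) (submxcol u i).
Proof. by rewrite /wnormsq dot_blocks; apply: eq_bigr => i _; rewrite blockdiag_mul dotZr. Qed.

Lemma wnormsq_ge (s : 'I_n -> R) u : (forall i, 0 < s i) ->
  pmin s * dot u u <= wnormsq (blockdiag d s) u.
Proof.
move=> s0; rewrite wnormsq_blockdiag dot_blocks mulr_sumr; apply: ler_sum => i _.
by rewrite ler_wpM2r ?dot_ge0 // pmin_le.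
Qed.

Lemma wnormsq_ge0 (s : 'I_n -> R) u : (forall i, 0 < s i) ->
  0 <= wnormsq (blockdiag d s) u.
Proof.
move=> s0; apply: le_trans (wnormsq_ge u s0).
by rewrite mulr_ge0 ?dot_ge0 // ltW // pmin_gt0.
Qed.

Lemma wnormsq_le (s : 'I_n -> R) u : (forall i, 0 < s i) ->
  wnormsq (blockdiag d s) u <= (\sum_i s i) * dot u u.
Proof.
move=> s0; rewrite wnormsq_blockdiag dot_blocks mulr_sumr; apply: ler_sum => i _.
by rewrite ler_wpM2r ?dot_ge0 // (bigD1 i) //= lerDl sumr_ge0 // => l _; exact: ltW.
Qed.

Lemma wnormsq_parallelogram (s : 'I_n -> R) u v : (forall i, 0 < s i) ->
  wnormsq (blockdiag d s) (u + v) <=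
    2 * wnormsq (blockdiag d s) u + 2 * wnormsq (blockdiag d s) v.
Proof.
move=> s0; rewrite !wnormsq_blockdiag !mulr_sumr -big_split /=; apply: ler_sum => i _.
rewrite submxcolD; have := dot_parallelogram (submxcol u i) (submxcol v i).
move=> /(ler_wpM2l (ltW (s0 i))); lra.
Qed.

Lemma prox_blockdiag phi (s : 'I_n -> R) v : proper_lsc_convex phi ->
  (forall i, 0 < s i) ->
  let u := prox (blockdiag d s) phi v in
  subdiff phi u (blockdiag d (fun i => (s i)^-1) *m (v - u)).
Proof.
move=> pphi s0 u; rewrite -blockdiag_inv //.
have sV0 i : 0 < (s i)^-1 by rewrite invr_gt0.
apply: (prox_subdiff v pphi _ (pmin_gt0 sV0)).
  by rewrite blockdiag_inv // blockdiag_tr.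
by move=> w; rewrite blockdiag_inv //; exact: wnormsq_ge.
Qed.

End Blocks.

Lemma submxcol_mulmx_Ublock {R : realType} {n m : nat} {d : 'I_n -> nat} {e : 'I_m -> nat}
  (A : 'M[R]_(\sum_j e j, \sum_i d i)%N) i (w : 'cV[R]_(d i)) j :
  submxcol (A *m Ublock w) j = submxblock A j i *m w.
Proof.
rewrite -submxcol_mul -[submxcol A j]submxrowK /Ublock mul_mxrow_mxcol.
rewrite [LHS](bigD1 i) //= dfwithin [X in _ + X]big1 ?addr0 => [|l li].
  by rewrite submxblockEv.
by rewrite dfwithout 1?eq_sym // mulmx0.
Qed.

Section Separable.
Context {R : realType} {n : nat} {d : 'I_n -> nat}.
Variables (g : bvec R d -> \bar R) (gi : forall i : 'I_n, 'cV[R]_(d i) -> \bar R).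
Hypothesis hg : eproper g.
Hypothesis hgsep : forall x, g x = (\sum_i @gi i (submxcol x i))%E.

Lemma block_neqNy i u : @gi i u != -oo%E.
Proof.
apply/eqP => giN; have [gN _] := hg.
have := gN (Ublock u); rewrite hgsep => /eqP; apply; apply/eqP.
by rewrite esum_eqNy; apply/existsP; exists i; rewrite /= submxcol_Ublock giN.
Qed.

Lemma edom_blocks x : edom g x <-> forall i, edom (@gi i) (submxcol x i).
Proof.
rewrite /edom /= hgsep lt_neqAle leey andbT.
rewrite esum_eqy; last by move=> i _; exact: block_neqNy.
rewrite negb_exists; split=> [/forallP h i|h].
  by have /= := h i; rewrite lt_neqAle leey andbT.
by apply/forallP => i /=; rewrite lt_eqF.
Qed.

Lemma block_fine i u : edom (@gi i) u -> @gi i u = (fine (@gi i u))%:E.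
Proof. by move=> iu; rewrite fineK // fin_numE block_neqNy lt_eqF. Qed.

Lemma fine_blocks x : edom g x -> fine (g x) = \sum_i fine (@gi i (submxcol x i)).
Proof.
move=> /edom_blocks xd; rewrite hgsep (eq_bigr _ (fun i _ => block_fine (xd i))).
by rewrite sumEFin.
Qed.

(** Moving block [i] of [x] alone isolates the inequality of that block. *)
Lemma block_subdiff x v i u : subdiff g x v -> edom (@gi i) u ->
  fine (@gi i (submxcol x i)) + dot (submxcol v i) (u - submxcol x i) <= fine (@gi i u).
Proof.
move=> sub ud.
have xd : edom g x by rewrite /edom /= (subdiff_fin hg sub) ltry.
pose w := x + Ublock (u - submxcol x i).
have wi : submxcol w i = u by rewrite /w submxcolD submxcol_Ublock addrC subrK.
have wl l : l != i -> submxcol w l = submxcol x l.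
  by move=> li; rewrite /w submxcolD submxcol_Ublock_neq 1?eq_sym // addr0.
have wd : edom g w.
  apply/edom_blocks => l; have [->|li] := eqVneq l i; first by rewrite wi.
  by rewrite wl //; exact: (edom_blocks x).1.
have := subdiff_le hg sub wd; rewrite /w addrAC subrr add0r dot_Ublock -/w.
rewrite !fine_blocks // (bigD1 i) //= [in leRHS](bigD1 i) //= wi.
rewrite [in leRHS](eq_bigr (fun l => fine (@gi l (submxcol x l)))) => [|l li]; last by rewrite wl.
lra.
Qed.

End Separable.

(** * Nonnegative supermartingales on the tree of draws *)

Section Upcrossings.
Context {R : realType} (a b : R).
Implicit Types (v : nat -> R).

(** [upward v k]: having last been at or below [a], the path is waiting to reach
    [b]. *)
Fixpoint upward v k : bool :=
  if k is k'.+1 then (if upward v k' then v k < b else v k <= a) else v k <= a.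

Definition upcrossings v k : nat :=
  (\sum_(l < k) (upward v l && (b <= v l.+1)%R))%N.

Definition upcrossing_gain v k : R :=
  \sum_(l < k) (if upward v l then v l.+1 - v l else 0).

Lemma eq_upward v v' k : (forall l, (l <= k)%N -> v l = v' l) ->
  upward v k = upward v' k.
Proof.
elim: k => [|k IH] vv /=; first by rewrite vv.
by rewrite IH ?vv // => l lk; apply: vv; exact: leqW.
Qed.

Lemma eq_upcrossing_gain v v' k : (forall l, (l <= k)%N -> v l = v' l) ->
  upcrossing_gain v k = upcrossing_gain v' k.
Proof.
move=> vv; apply: eq_bigr => l _.
rewrite (@eq_upward v v') ?vv //; first exact: ltnW.
by move=> l' l'l; apply: vv; apply: leq_trans l'l (ltnW _).
Qed.

(** Buying the path when it starts waiting for [b] and selling it when it gets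
    there earns [b - a] per upcrossing, up to the loss on the open position. *)
Lemma upcrossing_gain_ge v k :
  (b - a) * (upcrossings v k)%:R + (if upward v k then v k - a else 0)
    <= upcrossing_gain v k.
Proof.
elim: k => [|k IH].
  rewrite /upcrossings /upcrossing_gain !big_ord0 /= mulr0 add0r.
  by case: ifP => // va; rewrite subr_le0.
move: IH; rewrite /upcrossings /upcrossing_gain !big_ord_recr /= -/(upcrossings v k).
rewrite -/(upcrossing_gain v k) natrD.
case: (upward v k) => /= IH; rewrite ?addn0.
  by case: ltP => h /=; lra.
by case: ifP => h; lra.
Qed.

Lemma upcrossing_gain_ge_opp v k : 0 <= a -> a < b -> (forall l, 0 <= v l) ->
  - a <= upcrossing_gain v k /\ (b - a) * (upcrossings v k)%:R <= a + upcrossing_gain v k.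
Proof.
move=> a0 ab v0; have := upcrossing_gain_ge v k; have := v0 k.
have : 0 <= (b - a) * (upcrossings v k)%:R by rewrite mulr_ge0 ?subr_ge0 // ltW.
by case: ifP; split; lra.
Qed.

Lemma upcrossings_unbounded v : a < b ->
  (forall K, exists2 k, (K <= k)%N & v k <= a) ->
  (forall K, exists2 k, (K <= k)%N & b <= v k) ->
  forall m, exists k, (m <= upcrossings v k)%N.
Proof.
move=> ab fa fb; elim=> [|m [k0 mk0]]; first by exists 0%N.
have upS k : upcrossings v k.+1 = (upcrossings v k + (upward v k && (b <= v k.+1)%R))%N.
  by rewrite /upcrossings big_ord_recr.
have mono k k' : (k <= k')%N -> (upcrossings v k <= upcrossings v k')%N.
  elim: k' => [|k' IH]; first by rewrite leqn0 => /eqP ->.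
  rewrite leq_eqVlt => /orP[/eqP -> //|/IH h]; rewrite upS.
  exact: leq_trans h (leq_addr _ _).
have [k1 k01 vk1] := fa k0.
have up1 : upward v k1.
  case: k1 vk1 {k01} => //= k vk; case: ifP => // _; exact: le_lt_trans vk ab.
have [k2 k12 vk2] := fb k1.
exists k2.
have key j : (k1 <= j)%N ->
    (m < upcrossings v j)%N || (upward v j && (m <= upcrossings v j)%N).
  elim: j => [|j IH].
    by rewrite leqn0 => /eqP <-; rewrite up1 (leq_trans mk0 (mono _ _ k01)) orbT.
  rewrite leq_eqVlt => /orP[/eqP <-|].
    by rewrite up1 (leq_trans mk0 (mono _ _ k01)) orbT.
  move=> /IH /orP[h|/andP[uj mj]].
    by rewrite (leq_trans h) // mono.
  rewrite upS /= uj /=; case: ltP => h /=; first by rewrite addn0 mj orbT.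
  by rewrite addn1 ltnS mj.
have := key k2 k12; case: (ltnP m) => //= _ /andP[up2 _].
have : upward v k2 = false.
  case: k2 vk2 {k12 up2} => /= [|k] vk; first by apply/negbTE; rewrite -ltNge (lt_le_trans ab).
  by case: ifP => _; apply/negbTE; rewrite -?leNgt -?ltNge // (lt_le_trans ab).
by rewrite up2.
Qed.

End Upcrossings.

(** A bounded divergent sequence oscillates across an interval with rational
    endpoints. *)
Lemma cvgn_of_upcrossings {R : realType} (v : nat -> R) (M : R) :
  (forall k, 0 <= v k <= M) ->
  (forall q1 q2 : rat, 0 <= q1 -> q1 < q2 ->
     exists C : nat, forall k, (upcrossings (ratr q1) (ratr q2) v k <= C)%N) ->
  cvgn v.
Proof.
move=> vM nup; apply: contrapT => ncv.
have [l0 [phi jphi cvl]] : exists l : 'cV[R]_1, exists2 phi : nat -> nat,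
    (forall j, (j <= phi j)%N) & ((fun k => const_mx (v k) : 'cV[R]_1) \o phi) @ \oo --> l.
  apply: (@bounded_subseq _ _ _ (M ^+ 2)) => k; have /andP[v0 v1] := vM k.
  by rewrite dotE big_ord1 mxE -expr2 ler_pXn2r ?nnegrE // (le_trans v0 v1).
pose l := l0 0 0.
have vl : (v \o phi) @ \oo --> l.
  by have /cvg_colP/(_ 0) := cvl; under eq_fun do rewrite /= mxE.
have l0' : 0 <= l.
  by apply: (cvgr_to_ge vl); apply: nearW => k /=; have /andP[] := vM (phi k).
have near_l eps K : 0 < eps -> exists2 k, (K <= k)%N & `|l - v k| < eps.
  move=> e0; have /cvgrPdist_lt/(_ _ e0)[K' _ HK'] := vl.
  exists (phi (maxn K K')); first exact: leq_trans (leq_maxl _ _) (jphi _).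
  by apply: HK' => /=; exact: leq_maxr.
have [eps e0 far] : exists2 eps, 0 < eps & forall K, exists2 k, (K <= k)%N & eps <= `|l - v k|.
  apply: contrapT => no; apply: ncv; apply/cvg_ex; exists l; apply/cvgrPdist_lt => eps e0.
  apply: contrapT => nn; apply: no; exists eps => // K; apply: contrapT => nk.
  apply: nn; exists K => // k /= Kk; rewrite ltNge; apply/negP => h.
  by apply: nk; exists k.
have osc (c1 c2 d1 d2 : R) : c1 < c2 -> c2 < d1 -> d1 < d2 -> 0 <= c1 ->
    (forall K, exists2 k, (K <= k)%N & v k <= c1) ->
    (forall K, exists2 k, (K <= k)%N & d2 <= v k) -> False.
  move=> c12 c2d1 d12 c10 fa fb.
  have [q1 /[!in_itv] /= /andP[q1a q1b]] := rat_in_itvoo c12.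
  have [q2 /[!in_itv] /= /andP[q2a q2b]] := rat_in_itvoo d12.
  have q12 : ratr q1 < ratr q2 :> R by lra.
  have [C hC] : exists C : nat, forall k, (upcrossings (ratr q1) (ratr q2) v k <= C)%N.
    apply: nup; last by rewrite -(ltr_rat R).
    by rewrite -(ler0q R); lra.
  have fa' K : exists2 k, (K <= k)%N & v k <= ratr q1.
    by have [k Kk h] := fa K; exists k => //; lra.
  have fb' K : exists2 k, (K <= k)%N & ratr q2 <= v k.
    by have [k Kk h] := fb K; exists k => //; lra.
  have [k h] := upcrossings_unbounded q12 fa' fb' C.+1.
  by have := leq_trans h (hC k); rewrite ltnn.
have [h|h] := pselect (forall K, exists2 k, (K <= k)%N & eps <= v k - l).
  apply: (@osc (l + eps / 4) (l + eps / 3) (l + eps / 2) (l + eps)) => //; try lra.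
    move=> K; have [k Kk hk] := near_l (eps / 4) K ltac:(lra); exists k => //.
    by move: hk; rewrite ltr_norml; lra.
  by move=> K; have [k Kk hk] := h K; exists k => //; lra.
have [K0 hK0] : exists K0, forall k, (K0 <= k)%N -> v k - l < eps.
  apply: contrapT => no; apply: h => K; apply: contrapT => nk; apply: no; exists K => k Kk.
  by rewrite ltNge; apply/negP => hk; apply: nk; exists k.
have low K : exists2 k, (K <= k)%N & v k <= l - eps.
  have [k Kk hk] := far (maxn K K0); exists k; first exact: leq_trans (leq_maxl _ _) Kk.
  have := hK0 k (leq_trans (leq_maxr _ _) Kk).
  by move: hk; rewrite ler_normr => /orP[]; lra.
have le0 : 0 <= l - eps.
  by have [k _ hk] := low 0%N; have /andP[v0 _] := vM k; lra.
apply: (@osc (l - eps) (l - eps / 2) (l - eps / 3) (l - eps / 4)) => //; try lra.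
move=> K; have [k Kk hk] := near_l (eps / 4) K ltac:(lra); exists k => //.
by move: hk; rewrite ltr_norml; lra.
Qed.

Section Draws.
Context {R : realType} {n : nat} {dT : measure_display} {T : measurableType dT}
  (P : probability T R) (p : 'I_n -> R).
Hypothesis hp : forall i, 0 < p i.
Hypothesis hp1 : \sum_i p i = 1.
Implicit Types (xi : nat -> T -> 'I_n) (F G Q : seq 'I_n -> R).

Definition prefix xi k (w : T) : seq 'I_n := mkseq (xi^~ w) k.

(** The expectation of [F] at the first [k] draws. *)
Fixpoint expect k F : R :=
  if k is k'.+1 then expect k' (fun s => \sum_i p i * F (rcons s i)) else F [::].

Definition supermartingale Q := forall s, \sum_i p i * Q (rcons s i) <= Q s.

Lemma le_expect k F G : (forall s, F s <= G s) -> expect k F <= expect k G.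
Proof.
elim: k F G => //= k IH F G FG; apply: IH => s; apply: ler_sum => i _.
by rewrite ler_wpM2l // ltW.
Qed.

Lemma expect_sum k (c : 'I_n -> R) (F : 'I_n -> seq 'I_n -> R) :
  expect k (fun s => \sum_i c i * F i s) = \sum_i c i * expect k (F i).
Proof.
elim: k F => //= k IH F; rewrite -IH; congr expect; apply/funext => s.
under eq_bigr do rewrite mulr_sumr; rewrite exchange_big /=.
apply: eq_bigr => i _; rewrite mulr_sumr; apply: eq_bigr => j _; ring.
Qed.

Lemma expect_supermartingale k Q : supermartingale Q -> expect k Q <= Q [::].
Proof.
move=> sQ; elim: k => //= k IH; apply: le_trans IH; exact: le_expect.
Qed.

Section OneSequence.
Variables (xi : nat -> T -> 'I_n).
Hypothesis hxi : random_draws P p xi.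

Lemma prefix_event k (B : set (seq 'I_n)) :
  measurable [set w | B (prefix xi k w)] /\
  P [set w | B (prefix xi k w)] = (expect k (fun s => (`[< B s >])%:R))%:E.
Proof.
have [mxi pxi ixi] := hxi.
elim: k B => [|k IH] B.
  rewrite /prefix /=; case: asboolP => h.
    by rewrite (_ : mkset _ = setT) ?probability_setT //; apply/seteqP; split.
  by rewrite (_ : mkset _ = set0) ?measure0 //; apply/seteqP; split.
pose E i := [set w | B (rcons (prefix xi k w) i)] `&` xi k @^-1` [set i].
have BE : [set w | B (prefix xi k.+1 w)] = \big[setU/set0]_(i < n) E i.
  rewrite -bigcup_seq; apply/seteqP; split=> w /=; rewrite /prefix mkseqS.
    by move=> Bw; exists (xi k w) => //=; exact: mem_index_enum.
  by move=> [i _ [/= Bw ->]].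
have mE i : measurable (E i).
  by apply: measurableI; [have [] := IH [set s | B (rcons s i)]|exact: mxi].
have PE i : P (E i) = (p i * expect k (fun s => (`[< B (rcons s i) >])%:R))%:E.
  have [_ Pi] := IH [set s | B (rcons s i)].
  rewrite /E /prefix (ixi k [set s | B (rcons s i)] i) pxi.
  by rewrite -/(prefix xi k _) in Pi *; rewrite Pi muleC.
split; first by rewrite BE; exact: bigsetU_measurable.
rewrite BE measure_semi_additive_ord //.
- rewrite (eq_bigr _ (fun i _ => PE i)).
  by rewrite sumEFin /= expect_sum.
- by apply/trivIsetP => i j _ _ ij; apply/seteqP; split=> w //= -[[_ e1] [_ e2]];
    move: ij; rewrite -e1 -e2 eqxx.
- exact: bigsetU_measurable.
Qed.

(** Ville's inequality: stopping [Q] when it reaches [M] gives a supermartingale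
    that dominates the indicator of the event that [M] has been reached. *)
Lemma ville k Q (M : R) : 0 < M -> (forall s, 0 <= Q s) -> supermartingale Q ->
  (P [set w | exists2 l, (l <= k)%N & (M <= Q (prefix xi l w))%R]
    <= (Q [::] / M)%:E)%E.
Proof.
move=> M0 Q0 sQ.
pose hit : set (seq 'I_n) := [set s | exists2 l, (l <= size s)%N & M <= Q (take l s)].
have -> : [set w | exists2 l, (l <= k)%N & M <= Q (prefix xi l w)] =
    [set w | hit (prefix xi k w)].
  have tk l w : (l <= k)%N -> take l (prefix xi k w) = prefix xi l w.
    by move=> lk; rewrite /prefix /mkseq -map_take take_iota (minn_idPl lk).
  apply/seteqP; split=> w /= [l]; rewrite /prefix ?size_mkseq => lk h; exists l => //.
  - by rewrite size_mkseq.
  - by rewrite -/(prefix xi k w) tk.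
  - by rewrite -/(prefix xi k w) tk in h.
have [_ ->] := prefix_event k hit; rewrite lee_fin.
pose F s := if `[< hit s >] then 1 else Q s / M.
have tr s i l : (l <= size s)%N -> take l (rcons s i) = take l s.
  by move=> ls; rewrite -cats1 takel_cat.
have Fub s : Q s / M < 1 \/ hit s.
  have [h|h] := ltP (Q s / M) 1; [by left|right].
  by exists (size s) => //; rewrite take_size; rewrite ler_pdivlMr // mul1r in h.
have FQ s : (~ hit s -> F s = Q s / M) /\ (hit s -> F s = 1).
  by rewrite /F; case: asboolP.
have hitr s i : hit s -> hit (rcons s i).
  by move=> [l ls h]; exists l; rewrite ?size_rcons ?tr // leqW.
have sF : supermartingale F.
  move=> s; have [hs|hs] := pselect (hit s).
    rewrite (FQ s).2 // -hp1; apply: ler_sum => i _.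
    by rewrite (FQ _).2 ?mulr1 //; exact: hitr.
  rewrite (FQ s).1 //; apply: le_trans (_ : (\sum_i p i * Q (rcons s i)) / M <= _).
    rewrite mulr_suml; apply: ler_sum => i _; rewrite -mulrA ler_wpM2l ?(ltW (hp i)) //.
    have [h|h] := pselect (hit (rcons s i)); last by rewrite (FQ _).1.
    rewrite (FQ _).2 // ler_pdivlMr // mul1r; have [l] := h.
    rewrite size_rcons leq_eqVlt ltnS => /orP[/eqP ->|ls].
      by rewrite -(size_rcons s i) take_size.
    by rewrite tr // => h'; case: hs; exists l.
  by rewrite ler_pM2r ?invr_gt0 //; exact: sQ.
apply: le_trans (le_trans (expect_supermartingale k sF) _).
  apply: le_expect => s; rewrite /F; case: asboolP => //= _.
  by rewrite divr_ge0 // ltW.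
have [h|h] := pselect (hit [::]); last by rewrite (FQ _).1.
rewrite (FQ _).2 // ler_pdivlMr // mul1r.
by have [l] := h; rewrite leqn0 => /eqP ->.
Qed.

Lemma supermartingale_bounded Q : (forall s, 0 <= Q s) -> supermartingale Q ->
  {ae P, forall w, exists M : nat, forall k, Q (prefix xi k w) <= M%:R}.
Proof.
move=> Q0 sQ.
pose E (m k : nat) := [set w | exists2 l, (l <= k)%N & m.+1%:R <= Q (prefix xi l w)].
have mE m k : measurable (E m k).
  rewrite (_ : E m k = \bigcup_(l in [set l | (l <= k)%N])
      [set w | [set s | m.+1%:R <= Q s] (prefix xi l w)]).
    by apply: bigcup_measurable => l _; have [] := prefix_event l [set s | m.+1%:R <= Q s].
  by apply/seteqP; split=> w /= [l lk h]; exists l.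
have mU m : measurable (\bigcup_k E m k) by exact: bigcupT_measurable.
have PU m : (P (\bigcup_k E m k) <= (Q [::] / m.+1%:R)%:E)%E.
  have ndE : nondecreasing_seq (E m).
    by move=> k k' kk'; apply/subsetPset => w [l lk h]; exists l => //; exact: leq_trans kk'.
  have cvE := @nondecreasing_cvg_mu _ _ _ P _ (mE m) (mU m) ndE.
  rewrite -(cvg_lim _ cvE) //; apply: lime_le; first by apply/cvg_ex; eexists; exact: cvE.
  by apply: nearW => k; exact: ville.
exists (\bigcap_m \bigcup_k E m k); split.
- exact: bigcapT_measurable.
- apply/eqP; rewrite -measure_le0; apply/lee_addgt0Pr => eps e0; rewrite add0e.
  pose m := Num.truncn (Q [::] / eps).
  apply: le_trans (le_measure _ _ _ (_ : _ `<=` \bigcup_k E m k)) _.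
  + by rewrite inE; exact: bigcapT_measurable.
  + by rewrite inE.
  + by move=> w; apply.
  apply: le_trans (PU m) _; rewrite lee_fin ler_pdivrMr // mulrC -ler_pdivrMr //.
  by apply: ltW; rewrite truncnS_gt.
- move=> w /= nb m _; apply: contrapT => nm; apply: nb; exists m.+1 => k.
  apply: ltW; rewrite ltNge; apply/negP => h; apply: nm; exists k => //.
  by exists k.
Qed.

Lemma ae_forall_countable (C : countType) (A : C -> T -> Prop) :
  (forall c, {ae P, forall w, A c w}) -> {ae P, forall w, forall c, A c w}.
Proof.
move=> hA.
pose F m := if unpickle m is Some c then ~` [set w | A c w] else set0.
change (P.-negligible (~` [set w | forall c, A c w])).
apply: (@negligibleS _ _ _ _ (\bigcup_m F m)).
  move=> w /= /existsNP[c nA]; exists (pickle c) => //.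
  by rewrite /F pickleK.
apply: negligible_bigcup => m; rewrite /F; case: unpickle => [c|]; first exact: hA.
exact: negligible_set0.
Qed.

(** Doob's convergence theorem, game-theoretically: betting on the upcrossings
    of [[q1, q2]] with initial capital [q1] gives a nonnegative supermartingale,
    which would be unbounded on a path with infinitely many upcrossings. *)
Lemma supermartingale_cvg Q : (forall s, 0 <= Q s) -> supermartingale Q ->
  {ae P, forall w, cvgn (fun k => Q (prefix xi k w))}.
Proof.
move=> Q0 sQ.
pose path s l := Q (take l s).
pose G (q1 q2 : rat) s : R := ratr q1 + upcrossing_gain (ratr q1) (ratr q2) (path s) (size s).
have pathr s i l : (l <= size s)%N -> path s l = path (rcons s i) l.
  by move=> ls; rewrite /path -cats1 takel_cat.
have Gbd (q1 q2 : rat) : {ae P, forall w, 0 <= q1 -> q1 < q2 ->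
    exists M : nat, forall k, G q1 q2 (prefix xi k w) <= M%:R}.
  have [/andP[q10 q12]|no] := boolP ((0 <= q1) && (q1 < q2)); last first.
    by apply: aeW => w q10 q12; case/negP: no; rewrite q10.
  have G0 s : 0 <= G q1 q2 s.
    have [] := @upcrossing_gain_ge_opp _ (ratr q1) (ratr q2) (path s) (size s).
    - by rewrite ler0q.
    - by rewrite ltr_rat.
    - by move=> l; exact: Q0.
    by rewrite /G; lra.
  have sG : supermartingale (G q1 q2).
    move=> s; have Gr i : G q1 q2 (rcons s i) = G q1 q2 s +
        (if upward (ratr q1) (ratr q2) (path s) (size s) then Q (rcons s i) - Q s else 0).
      rewrite /G size_rcons /upcrossing_gain big_ord_recr /= -/(upcrossing_gain _ _ _ _).
      rewrite -(@eq_upcrossing_gain _ _ _ (path s)); last by move=> l; exact: pathr.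
      rewrite -(@eq_upward _ _ _ (path s)); last by move=> l; exact: pathr.
      have -> : path (rcons s i) (size s).+1 = Q (rcons s i).
        by rewrite /path -(size_rcons s i) take_size.
      have -> : path (rcons s i) (size s) = Q s by rewrite -pathr // /path take_size.
      by rewrite addrA.
    under eq_bigr do rewrite Gr mulrDr.
    have sum1 c : \sum_i p i * c = c by rewrite -mulr_suml hp1 mul1r.
    rewrite big_split /= sum1 gerDl.
    case: (upward _ _ (path s) _); last by rewrite big1 // => i _; rewrite mulr0.
    under eq_bigr do rewrite mulrBr.
    by rewrite sumrB sum1 subr_le0; exact: sQ.
  apply: filterS (supermartingale_bounded G0 sG) => w [M hM] _ _.
  by exists M.
have := @ae_forall_countable _ (fun (q : rat * rat) w => 0 <= q.1 -> q.1 < q.2 ->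
    exists M : nat, forall k, G q.1 q.2 (prefix xi k w) <= M%:R) (fun q => Gbd q.1 q.2).
apply: filterS2 (supermartingale_bounded Q0 sQ) => w [M hM] hG.
apply: (@cvgn_of_upcrossings _ _ M%:R) => [k|q1 q2 q10 q12]; first by rewrite Q0 hM.
have [C hC] := hG (q1, q2) q10 q12.
have q12' : 0 < ratr q2 - ratr q1 :> R by rewrite subr_gt0 ltr_rat.
exists (Num.truncn (C%:R / (ratr q2 - ratr q1) : R)) => k.
rewrite truncn_ge_nat ?divr_ge0 ?(ltW q12') // ler_pdivlMr //.
apply: le_trans (hC k); rewrite /G /prefix size_mkseq /=.
rewrite -(@eq_upcrossing_gain _ _ _ (fun l => Q (prefix xi l w))); last first.
  by move=> l lk; rewrite /path /prefix /mkseq -map_take take_iota (minn_idPl lk).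
rewrite mulrC.
have [] := @upcrossing_gain_ge_opp _ (ratr q1) (ratr q2) (fun l => Q (prefix xi l w)) k => //.
- by rewrite ler0q.
- by rewrite ltr_rat.
Qed.

(** As long as [i] is not drawn, a player betting all on this event sees the
    capital grow geometrically. *)
Lemma ae_drawn i : {ae P, forall w, exists k, xi k w = i}.
Proof.
(* The fair growth factor is [1 / (1 - p i)]; [1 + p i] is below it and makes
   sense even when [p i = 1]. *)
pose Q s : R := if i \in s then 0 else (1 + p i) ^+ size s.
have pi0 : 0 < 1 + p i by rewrite addr_gt0.
have Q0 s : 0 <= Q s by rewrite /Q; case: ifP => // _; rewrite exprn_ge0 // ltW.
have sQ : supermartingale Q.
  move=> s; rewrite /Q; case: ifP => is_.
    by rewrite big1 // => j _; rewrite mem_rcons in_cons is_ orbT mulr0.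
  rewrite (bigD1 i) //= mem_rcons in_cons eqxx /= mulr0 add0r.
  rewrite (eq_bigr (fun j => p j * (1 + p i) ^+ (size s).+1)); last first.
    move=> j ji; rewrite mem_rcons in_cons is_ orbF eq_sym (negbTE ji).
    by rewrite size_rcons.
  rewrite -mulr_suml.
  have -> : \sum_(j | j != i) p j = 1 - p i.
    by rewrite -hp1 [in RHS](bigD1 i) //= addrC addrK.
  rewrite exprS mulrA ger_pMl ?exprn_gt0 //.
  have := sqr_ge0 (p i); lra.
apply: filterS (supermartingale_bounded Q0 sQ) => w [M hM].
apply: contrapT => nd.
have nin k : i \notin prefix xi k w.
  by apply/negP => /mapP[l _ il]; apply: nd; exists l.
have bern k : 1 + k%:R * p i <= (1 + p i) ^+ k.
  elim: k => [|k IH]; first by rewrite mul0r addr0 expr0.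
  rewrite exprS -natr1; apply: le_trans (ler_wpM2l (ltW pi0) IH).
  have : 0 <= k%:R * (p i) ^+ 2 by rewrite mulr_ge0 // sqr_ge0.
  lra.
have := hM (Num.truncn (M%:R / p i)).+1; rewrite /Q (negbTE (nin _)) size_mkseq.
move/(le_trans (bern _)); have := truncnS_gt (M%:R / p i).
rewrite ltr_pdivrMr //; lra.
Qed.

Lemma random_draws_shift L : random_draws P p (fun k => xi (k + L)%N).
Proof.
have [mxi pxi ixi] := hxi; split=> [k i|k i|k B i] /=; [exact: mxi|exact: pxi|].
have := ixi (k + L)%N [set s | B (drop L s)] i => /=.
have -> : [set w | B (drop L (mkseq (fun l => xi l w) (k + L)))] =
    [set w | B (mkseq (fun l => xi (l + L)%N w) k)] => //.
apply/seteqP; split=> w /=; have -> : drop L (mkseq (xi^~ w) (k + L)) =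
    mkseq (fun l => xi (l + L)%N w) k => //.
all: rewrite /mkseq -map_drop drop_iota addnK add0n -[L in iota L](addn0 L) iotaDl.
all: by rewrite -map_comp; apply: eq_map => l /=; rewrite addnC.
Qed.

End OneSequence.

Lemma ae_drawn_infinitely_often xi : random_draws P p xi ->
  {ae P, forall w, forall i L, exists2 k, (L <= k)%N & xi k w = i}.
Proof.
move=> hxi; apply: ae_forall_countable => i; apply: ae_forall_countable => L.
apply: filterS (ae_drawn (random_draws_shift hxi L) i) => w [k ki].
by exists (k + L)%N => //; exact: leq_addl.
Qed.

End Draws.

(** * Expected decrease of the Lyapunov function over one iteration *)

Section Step.
Context {R : realType} {n m : nat} {d : 'I_n -> nat} {e : 'I_m -> nat}.
Variables (f : bvec R d -> R) (g : bvec R d -> \bar R) (h : bvec R e -> \bar R).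
Variable gi : forall i : 'I_n, 'cV[R]_(d i) -> \bar R.
Variable A : 'M[R]_(\sum_j e j, \sum_i d i)%N.
Variables (beta p : 'I_n -> R) (theta : 'I_m -> R) (tau : 'I_n -> R) (sigma : 'I_m -> R).
Hypothesis hf : proper_lsc_convex (fun x => (f x)%:E).
Hypothesis hg : proper_lsc_convex g.
Hypothesis hh : proper_lsc_convex h.
Hypothesis hgsep : forall x, g x = (\sum_i @gi i (submxcol x i))%E.
Hypothesis hfdiff : forall x, differentiable f x.
Hypothesis hfLip : forall (x : bvec R d) (i : 'I_n) (u : 'cV[R]_(d i)),
  f (x + Ublock u)
    <= f x + dot (submxcol (grad f x) i) u + beta i / 2 * enorm u ^+ 2.
Hypothesis hp : forall i, 0 < p i.
Hypothesis hp1 : \sum_i p i = 1.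
Hypothesis hA : forall j : 'I_m, exists i : 'I_n, submxblock A j i != 0.
Hypothesis htheta : forall j, theta j = pi_dual A p j / pmin p.
Hypothesis htau : forall i, 0 < tau i.
Hypothesis hsigma : forall j, 0 < sigma j.
Hypothesis hstep : forall i : 'I_n,
  ((tau i)%:E <
   (2 * p i - pmin p)%:E /
   (beta i * p i + (pmin p)^-1 * p i *
      \sum_j pi_dual A p j * sigma j * opnorm (submxblock A j i) ^+ 2)%:E)%E.

Let proper_g : eproper g. Proof. by case: hg. Qed.
Let proper_h : eproper (conjugate h).
Proof. by case: (conjugate_proper_lsc_convex hh). Qed.
Let fcvx : econvex (fun x => (f x)%:E). Proof. by case: hf. Qed.
Let pm0 : 0 < pmin p. Proof. exact: pmin_gt0. Qed.

Definition hstar (y : bvec R e) : R := fine (conjugate h y).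
Definition gfin (i : 'I_n) (u : 'cV[R]_(d i)) : R := fine (@gi i u).

Local Notation yb z := (ybar h A sigma z.1 z.2).
Local Notation xb z := (xbar f g h A tau sigma z.1 z.2).
Local Notation step := (purecd_step f g h A theta tau sigma).

Lemma pi_dual_gt0 j : 0 < pi_dual A p j.
Proof.
have [i Ai] := hA j; rewrite /pi_dual (bigD1 i) //=.
by rewrite ltr_pwDl // sumr_ge0 // => l _; exact: ltW.
Qed.

(** The bound on [tau i] multiplied out: its strictness is [0 < slack i], whatever
    the sign of the denominator. *)
Definition slack i : R := (2 * p i - pmin p) / tau i - beta i * p i -
  (pmin p)^-1 * p i *
      \sum_j pi_dual A p j * sigma j * opnorm (submxblock A j i) ^+ 2.

Lemma slack_gt0 i : 0 < slack i.
Proof.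
rewrite /slack -addrA -opprD; set D := beta i * p i + _.
have num0 : 0 < 2 * p i - pmin p.
  have := pmin_le p i; have := hp i; lra.
have t0 := htau i; have := hstep i; rewrite -/D inver.
rewrite subr_gt0 ltr_pdivlMr //; case: eqP => [->|D0]; first by rewrite mul0r.
rewrite -EFinM lte_fin => lt; have [Dp|Dn] := ltP 0 D.
  by rewrite (mulrC D); move: lt; rewrite ltr_pdivlMr.
have D0' : D < 0 by rewrite lt_neqAle Dn andbT; apply/eqP.
have : (2 * p i - pmin p) / D < 0 by rewrite pmulr_rlt0 // invr_lt0.
lra.
Qed.

Lemma step_fst z i : (step z i).1 =
  z.1 + Ublock (submxcol (xb z) i - submxcol z.1 i).
Proof.
case: z => x y /=; apply/mxcolP => l; rewrite mxcolK submxcolD.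
have [->|li] := eqVneq l i; first by rewrite submxcol_Ublock addrC subrK.
by rewrite submxcol_Ublock_neq 1?eq_sym // addr0.
Qed.

Lemma step_fst_block z i l : submxcol (step z i).1 l =
  if l == i then submxcol (xb z) l else submxcol z.1 l.
Proof. by case: z => x y /=; rewrite mxcolK. Qed.

Lemma step_snd_block z i j : submxcol (step z i).2 j =
  if submxblock A j i != 0
  then submxcol (yb z) j + (sigma j * theta j) *:
         (submxblock A j i *m (submxcol (xb z) i - submxcol z.1 i))
  else submxcol z.2 j.
Proof.
have := step_fst z i; case: z => x y /= ->; rewrite mxcolK; case: ifP => // _.
by rewrite addrAC subrr add0r submxcol_mulmx_Ublock.
Qed.

(** Drawing [i] moves block [i] of [x] alone, so that a sum over the blocks
    changes by a single term. *)
Lemma expect_step_fst z (phi : forall i, 'cV[R]_(d i) -> R) :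
  \sum_i p i * (\sum_l phi l (submxcol (step z i).1 l)) =
  \sum_l phi l (submxcol z.1 l) +
  \sum_i p i * (phi i (submxcol (xb z) i) - phi i (submxcol z.1 i)).
Proof.
rewrite -[X in _ = X + _]mul1r -hp1 mulr_suml -big_split /=; apply: eq_bigr => i _.
rewrite -mulrDr; congr (_ * _).
rewrite (bigD1 i) //= [in RHS](bigD1 i) //= step_fst_block eqxx.
rewrite (eq_bigr (fun l => phi l (submxcol z.1 l))) => [|l li]; last first.
  by rewrite step_fst_block (negbTE li).
ring.
Qed.

(** Likewise for [y], each block of which moves with the draws of several [i]. *)
Lemma expect_step_snd z (psi : forall j, 'cV[R]_(e j) -> R) :
  \sum_i p i * (\sum_j psi j (submxcol (step z i).2 j)) =
  \sum_j psi j (submxcol z.2 j) +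
  \sum_j \sum_(i | submxblock A j i != 0) p i *
    (psi j (submxcol (yb z) j + (sigma j * theta j) *:
         (submxblock A j i *m (submxcol (xb z) i - submxcol z.1 i)))
     - psi j (submxcol z.2 j)).
Proof.
transitivity (\sum_i \sum_j p i * psi j (submxcol (step z i).2 j)).
  by apply: eq_bigr => i _; rewrite mulr_sumr.
rewrite exchange_big /= -[RHS]big_split /=; apply: eq_bigr => j _.
rewrite -[X in _ = X + _]mul1r -hp1 mulr_suml [X in _ = _ + X]big_mkcond -[RHS]big_split /=.
apply: eq_bigr => i _; rewrite step_snd_block; case: ifP => _; ring.
Qed.

(** Fermat's rule for the two proximal steps. *)
Lemma xbar_subdiff z : subdiff g (xb z)
  (blockdiag d (fun i => (tau i)^-1) *m (z.1 - xb z) - (grad f z.1 + A^T *m yb z)).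
Proof.
have := prox_blockdiag (z.1 - blockdiag d tau *m (grad f z.1 + A^T *m yb z)) hg htau.
rewrite /= -/(xbar f g h A tau sigma z.1 z.2) => sub.
rewrite (_ : _ - _ = blockdiag d (fun i => (tau i)^-1) *m
   (z.1 - blockdiag d tau *m (grad f z.1 + A^T *m yb z) - xb z)) //.
apply/mxcolP => i; rewrite !(submxcolB, blockdiag_mul).
rewrite !scalerBr scalerA mulVf ?gt_eqF // scale1r.
by rewrite addrAC.
Qed.

Lemma ybar_subdiff z : subdiff (conjugate h) (yb z)
  (blockdiag e (fun j => (sigma j)^-1) *m (z.2 - yb z) + A *m z.1).
Proof.
have := prox_blockdiag (z.2 + blockdiag e sigma *m (A *m z.1))
  (conjugate_proper_lsc_convex hh) hsigma.
rewrite /= -/(ybar h A sigma z.1 z.2) => sub.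
rewrite (_ : _ + _ = blockdiag e (fun j => (sigma j)^-1) *m
   (z.2 + blockdiag e sigma *m (A *m z.1) - yb z)) //.
apply/mxcolP => j; rewrite !(submxcolB, submxcolD, blockdiag_mul).
rewrite !(scalerBr, scalerDr) scalerA mulVf ?gt_eqF // scale1r.
by rewrite addrAC.
Qed.

Lemma xbar_edom z : edom g (xb z).
Proof. by rewrite /edom /= (subdiff_fin proper_g (xbar_subdiff z)) ltry. Qed.

Lemma ybar_edom z : edom (conjugate h) (yb z).
Proof. by rewrite /edom /= (subdiff_fin proper_h (ybar_subdiff z)) ltry. Qed.

Lemma step_edom_block z i l :
  edom (@gi l) (submxcol z.1 l) -> edom (@gi l) (submxcol (step z i).1 l).
Proof.
rewrite step_fst_block; case: ifP => // _ _.
exact: ((edom_blocks proper_g hgsep _).1 (xbar_edom z)).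
Qed.

Section Lyapunov.
Variable zs : bvec R d * bvec R e.
Hypothesis hzs : saddle_points f g h A zs.

Lemma saddle_fst : subdiff g zs.1 (- (grad f zs.1 + A^T *m zs.2)).
Proof.
have [[v sv ev] _] := hzs.
suff -> : - (grad f zs.1 + A^T *m zs.2) = v by [].
apply/eqP; rewrite eq_sym -addr_eq0 [eqbLHS](_ : _ = grad f zs.1 + v + A^T *m zs.2).
  by rewrite -ev.
by rewrite addrA (addrC v).
Qed.

Lemma saddle_snd : subdiff (conjugate h) zs.2 (A *m zs.1).
Proof.
have [_ [w sw ew]] := hzs.
by have -> : A *m zs.1 = w by apply/eqP; rewrite -subr_eq0 -ew.
Qed.

(** Bregman-type gaps: each function minus the affine minorant that the optimality
    conditions provide at the saddle point. *)
Definition gapg i (u : 'cV[R]_(d i)) : R :=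
  gfin u - gfin (submxcol zs.1 i) +
  dot (submxcol (grad f zs.1 + A^T *m zs.2) i) (u - submxcol zs.1 i).

Definition gapf (x : bvec R d) : R := f x - f zs.1 - dot (grad f zs.1) (x - zs.1).

Definition gaph (y : bvec R e) : R :=
  hstar y - hstar zs.2 - dot (A *m zs.1) (y - zs.2).

Lemma gapg_ge0 i (u : 'cV[R]_(d i)) : edom (@gi i) u -> 0 <= gapg u.
Proof.
move=> /(block_subdiff proper_g hgsep saddle_fst).
rewrite submxcolN dotNl /gapg /gfin; lra.
Qed.

Lemma gapf_ge0 x : 0 <= gapf x.
Proof. by have := convex_grad fcvx hfdiff zs.1 x; rewrite /gapf; lra. Qed.

Lemma gaph_ge0 y : edom (conjugate h) y -> 0 <= gaph y.
Proof. by move=> /(subdiff_le proper_h saddle_snd); rewrite /gaph /hstar; lra. Qed.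

(** Dividing the weight of a block by its update probability makes the expected
    change of a squared distance the one of a full update. The expected change of
    the gap of [g] in block [i] is [p i / pmin p - 1] times the one of a full
    update, a factor that it shares with the dual cross term. *)
Definition lyap_fst i (u : 'cV[R]_(d i)) : R :=
  (2 * tau i * p i)^-1 * dot (u - submxcol zs.1 i) (u - submxcol zs.1 i) +
  ((pmin p)^-1 - (p i)^-1) * gapg u.

Definition lyap_snd j (v : 'cV[R]_(e j)) : R :=
  (2 * sigma j * pi_dual A p j)^-1 * dot (v - submxcol zs.2 j) (v - submxcol zs.2 j).

Definition lyapunov (z : bvec R d * bvec R e) : R :=
  \sum_i lyap_fst (submxcol z.1 i) + \sum_j lyap_snd (submxcol z.2 j) +
  (pmin p)^-1 * gapf z.1.

Definition decrease (z : bvec R d * bvec R e) : R :=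
  \sum_i (gapg (submxcol (xb z) i) + slack i / (2 * pmin p) *
     dot (submxcol (xb z) i - submxcol z.1 i) (submxcol (xb z) i - submxcol z.1 i)) +
  \sum_j (2 * sigma j)^-1 *
     dot (submxcol (yb z) j - submxcol z.2 j) (submxcol (yb z) j - submxcol z.2 j) +
  gaph (yb z) + gapf z.1.

(* The increments, from the saddle point, of the gradient and of the dual part
   [A^T *m y] of the optimality condition in [x]. *)
Let r (z : bvec R d * bvec R e) := grad f z.1 - grad f zs.1.
Let a (z : bvec R d * bvec R e) := A^T *m (yb z - zs.2).

Lemma gapf_le z : gapf z.1 <= \sum_i dot (submxcol (r z) i) (submxcol z.1 i - submxcol zs.1 i).
Proof.
rewrite (eq_bigr _ (fun i _ => congr1 (dot _) (esym (submxcolB _ _ i)))) -dot_blocks.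
have := convex_grad fcvx hfdiff z.1 zs.1.
rewrite /r /gapf -(opprB z.1 zs.1) dotNr dotDl (dotNl (grad f zs.1)); lra.
Qed.

Lemma gaph_le z : gaph (yb z) <=
  \sum_i dot (submxcol (a z) i) (submxcol z.1 i - submxcol zs.1 i) -
  \sum_j (sigma j)^-1 * dot (submxcol (yb z) j - submxcol z.2 j)
                           (submxcol (yb z) j - submxcol zs.2 j).
Proof.
rewrite (eq_bigr _ (fun i _ => congr1 (dot _) (esym (submxcolB _ _ i)))) -dot_blocks /a.
have zsdom : edom (conjugate h) zs.2.
  by rewrite /edom /= (subdiff_fin proper_h saddle_snd) ltry.
have := subdiff_le proper_h (ybar_subdiff z) zsdom.
rewrite -/(hstar (yb z)) -/(hstar zs.2) /gaph.
have -> : dot (A^T *m (yb z - zs.2)) (z.1 - zs.1) = dot (A *m z.1 - A *m zs.1) (yb z - zs.2).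
  by rewrite -mulmxBr dotC dot_mulmxl dotC.
have -> : \sum_j (sigma j)^-1 * dot (submxcol (yb z) j - submxcol z.2 j)
    (submxcol (yb z) j - submxcol zs.2 j) =
    dot (blockdiag e (fun j => (sigma j)^-1) *m (z.2 - yb z)) (zs.2 - yb z).
  rewrite dot_blocks; apply: eq_bigr => j _.
  rewrite blockdiag_mul dotZl !submxcolB -!(opprB (submxcol (yb z) j)).
  by rewrite dotNl dotNr opprK.
rewrite dotDl (dotDl (A *m z.1)) (dotNl (A *m zs.1)) -(opprB (yb z) zs.2).
rewrite (dotNr (A *m z.1)); lra.
Qed.

Lemma gapg_le z i (u : 'cV[R]_(d i)) : edom (@gi i) u ->
  gapg (submxcol (xb z) i) - gapg u <=
  - dot (submxcol (r z) i + submxcol (a z) i) (submxcol (xb z) i - u)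
  - (tau i)^-1 * dot (submxcol (xb z) i - submxcol z.1 i) (submxcol (xb z) i - u).
Proof.
move=> ud; have := block_subdiff proper_g hgsep (xbar_subdiff z) ud.
rewrite submxcolB blockdiag_mul submxcolB -/(gfin u) -/(gfin (submxcol (xb z) i)).
rewrite /gapg.
have -> : grad f z.1 + A^T *m yb z = r z + a z + (grad f zs.1 + A^T *m zs.2).
  by rewrite /r /a mulmxBr addrACA !subrK.
rewrite !submxcolD.
move: (submxcol (r z) i + submxcol (a z) i)
  (submxcol (grad f zs.1) i + submxcol (A^T *m zs.2) i) => b c.
move: (submxcol (xb z) i) (submxcol z.1 i) (submxcol zs.1 i) => X x xs.
rewrite !(dotDl, dotDr, dotNl, dotNr, dotZl, dotZr); lra.
Qed.

Let delta (z : bvec R d * bvec R e) i := submxcol (xb z) i - submxcol z.1 i.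

Lemma dual_cross z i :
  \sum_j dot (submxcol (yb z) j - submxcol zs.2 j) (submxblock A j i *m delta z i) =
  dot (submxcol (a z) i) (delta z i).
Proof.
rewrite -dot_Ublock /a dotC -dot_mulmxl dotC dot_blocks; apply: eq_bigr => j _.
by rewrite submxcolB submxcol_mulmx_Ublock.
Qed.

(** The choice of [theta] makes the coefficient of the cross term independent of
    [j], so that it can be written with [a z] instead of the blocks of [A]. *)
Lemma expect_lyap_snd z :
  \sum_i p i * (\sum_j lyap_snd (submxcol (step z i).2 j)) <=
  \sum_j lyap_snd (submxcol z.2 j) +
  \sum_j (2 * sigma j)^-1 *
    (dot (submxcol (yb z) j - submxcol zs.2 j) (submxcol (yb z) j - submxcol zs.2 j)
     - dot (submxcol z.2 j - submxcol zs.2 j) (submxcol z.2 j - submxcol zs.2 j)) +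
  \sum_i p i * ((pmin p)^-1 * dot (submxcol (a z) i) (delta z i) +
    (2 * pmin p ^+ 2)^-1 * (\sum_j pi_dual A p j * sigma j * opnorm (submxblock A j i) ^+ 2)
      * dot (delta z i) (delta z i)).
Proof.
rewrite expect_step_snd -[leRHS]addrA lerD2l.
pose Y j := submxcol z.2 j - submxcol zs.2 j.
pose Yb j := submxcol (yb z) j - submxcol zs.2 j.
pose q j i := (pmin p)^-1 * dot (Yb j) (submxblock A j i *m delta z i) +
    (2 * pmin p ^+ 2)^-1 * (pi_dual A p j * sigma j * opnorm (submxblock A j i) ^+ 2)
      * dot (delta z i) (delta z i).
apply: (@le_trans _ _ (\sum_j ((2 * sigma j)^-1 * (dot (Yb j) (Yb j) - dot (Y j) (Y j))
   + \sum_i p i * q j i))); last first.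
  rewrite big_split /= lerD2l exchange_big /= le_eqVlt; apply/orP; left; apply/eqP.
  apply: eq_bigr => i _; rewrite -mulr_sumr big_split /= -mulr_sumr dual_cross.
  by rewrite -mulr_suml -mulr_sumr.
apply: ler_sum => j _.
have s0 := hsigma j; have pi0 := pi_dual_gt0 j.
have -> : (2 * sigma j)^-1 * (dot (Yb j) (Yb j) - dot (Y j) (Y j)) =
    \sum_(i | submxblock A j i != 0) p i *
      ((2 * sigma j * pi_dual A p j)^-1 * (dot (Yb j) (Yb j) - dot (Y j) (Y j))).
  rewrite -mulr_suml -/(pi_dual A p j); field.
  by rewrite !gt_eqF.
rewrite big_mkcond [X in _ <= X + _]big_mkcond -big_split /=; apply: ler_sum => i _.
have q0 : 0 <= (2 * pmin p ^+ 2)^-1 by rewrite invr_ge0 mulr_ge0 // sqr_ge0.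
case: (boolP (submxblock A j i != 0)) => [Aji|/negPn/eqP Aji]; last first.
  rewrite add0r mulr_ge0 ?(ltW (hp i)) // /q Aji mul0mx dot0r mulr0 add0r.
  apply: mulr_ge0 (dot_ge0 _); apply: mulr_ge0 q0 _.
  by rewrite mulr_ge0 ?sqr_ge0 // mulr_ge0 // ltW.
rewrite -mulrDr ler_wpM2l ?(ltW (hp i)) // /lyap_snd -mulrBr.
rewrite -/(delta z i) htheta.
have -> : submxcol (yb z) j + (sigma j * (pi_dual A p j / pmin p)) *:
    (submxblock A j i *m delta z i) - submxcol zs.2 j = Yb j +
    (sigma j * (pi_dual A p j / pmin p)) *: (submxblock A j i *m delta z i).
  by rewrite addrAC.
have := opnorm_bound (submxblock A j i) (delta z i).
rewrite -/(Y j) /q; move: (submxblock A j i *m delta z i) (Yb j) (Y j) => w v1 v2.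
move: (dot (delta z i) (delta z i)) => dd.
rewrite !(dotDl, dotDr, dotZl, dotZr) (dotC w).
move: (dot v1 v1) (dot v2 v2) (dot v1 w) (dot w w) => x1 x2 x3 ww hw.
rewrite [leLHS](_ : _ = (2 * sigma j * pi_dual A p j)^-1 * (x1 - x2) + ((pmin p)^-1 * x3 +
    (2 * pmin p ^+ 2)^-1 * (pi_dual A p j * sigma j) * ww)); last first.
  by field; rewrite !gt_eqF.
rewrite !lerD2l -[leRHS]mulrA -[leLHS]mulrA.
rewrite (ler_wpM2l q0) // -[leRHS]mulrA.
by rewrite ler_wpM2l // mulr_ge0 // ltW.
Qed.

Lemma expect_gapf z : \sum_i p i * gapf (step z i).1 <= gapf z.1 +
  \sum_i p i * (dot (submxcol (r z) i) (delta z i) +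
    beta i / 2 * dot (delta z i) (delta z i)).
Proof.
have -> : gapf z.1 = \sum_i p i * gapf z.1 by rewrite -mulr_suml hp1 mul1r.
rewrite -big_split /=; apply: ler_sum => i _.
rewrite -mulrDr ler_wpM2l ?(ltW (hp i)) // step_fst /gapf.
have := hfLip z.1 (delta z i); rewrite enorm_sqr -/(delta z i).
move: (delta z i) => D.
have -> : z.1 + Ublock D - zs.1 = z.1 - zs.1 + Ublock D.
  by rewrite addrAC.
rewrite [dot _ (_ + Ublock _)]dotDr dot_Ublock /r submxcolB [dot (_ - _) D]dotDl dotNl.
lra.
Qed.

(** The Lyapunov function decreases in conditional expectation. The optimality of
    [xb z] is used against the saddle point and, with weight [p i / pmin p - 1],
    against the current point: the second use absorbs the part of the dual cross
    term that non-uniform probabilities leave behind. *)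
Theorem lyapunov_decrease z : edom g z.1 ->
  \sum_i p i * lyapunov (step z i) <= lyapunov z - decrease z.
Proof.
move=> zdom; have zi i := (edom_blocks proper_g hgsep z.1).1 zdom i.
have zsi i : edom (@gi i) (submxcol zs.1 i).
  apply: (edom_blocks proper_g hgsep zs.1).1.
  by rewrite /edom /= (subdiff_fin proper_g saddle_fst) ltry.
have -> : \sum_i p i * lyapunov (step z i) =
    \sum_i p i * (\sum_l lyap_fst (submxcol (step z i).1 l)) +
    \sum_i p i * (\sum_j lyap_snd (submxcol (step z i).2 j)) +
    (pmin p)^-1 * \sum_i p i * gapf (step z i).1.
  rewrite mulr_sumr -!big_split /=; apply: eq_bigr => i _; rewrite /lyapunov; ring.
rewrite (expect_step_fst z lyap_fst).
have hy := expect_lyap_snd z.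
have hgf : (pmin p)^-1 * (\sum_i p i * gapf (step z i).1) <= (pmin p)^-1 * gapf z.1 +
    (pmin p)^-1 * \sum_i p i * (dot (submxcol (r z) i) (delta z i) +
    beta i / 2 * dot (delta z i) (delta z i)).
  by rewrite -mulrDr ler_wpM2l ?expect_gapf // invr_ge0 ltW.
have hf' := gapf_le z; have hh' := gaph_le z.
have dual j : (2 * sigma j)^-1 *
    (dot (submxcol (yb z) j - submxcol zs.2 j) (submxcol (yb z) j - submxcol zs.2 j)
     - dot (submxcol z.2 j - submxcol zs.2 j) (submxcol z.2 j - submxcol zs.2 j)) =
   (sigma j)^-1 * dot (submxcol (yb z) j - submxcol z.2 j)
                           (submxcol (yb z) j - submxcol zs.2 j) -
   (2 * sigma j)^-1 *
     dot (submxcol (yb z) j - submxcol z.2 j) (submxcol (yb z) j - submxcol z.2 j).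
  have -> : (sigma j)^-1 = (2 * sigma j)^-1 * 2 by field; rewrite gt_eqF.
  rewrite -mulrA -mulrBr; congr (_ * _).
  move: (submxcol (yb z) j) (submxcol z.2 j) (submxcol zs.2 j) => y1 y2 y3.
  rewrite !(dotDl, dotDr, dotNl, dotNr) (dotC y2 y1) (dotC y3 y1) (dotC y3 y2); ring.
rewrite (eq_bigr _ (fun j _ => dual j)) sumrB in hy.
have primal i : p i * (lyap_fst (submxcol (xb z) i) - lyap_fst (submxcol z.1 i)) +
    p i * ((pmin p)^-1 * dot (submxcol (a z) i) (delta z i) +
    (2 * pmin p ^+ 2)^-1 * (\sum_j pi_dual A p j * sigma j * opnorm (submxblock A j i) ^+ 2)
      * dot (delta z i) (delta z i)) +
    (pmin p)^-1 * (p i * (dot (submxcol (r z) i) (delta z i) +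
      beta i / 2 * dot (delta z i) (delta z i))) +
    dot (submxcol (r z) i) (submxcol z.1 i - submxcol zs.1 i) +
    dot (submxcol (a z) i) (submxcol z.1 i - submxcol zs.1 i) +
    (gapg (submxcol (xb z) i) + slack i / (2 * pmin p) *
     dot (submxcol (xb z) i - submxcol z.1 i) (submxcol (xb z) i - submxcol z.1 i)) <= 0.
  have h1 := gapg_le z (zsi i).
  have g0 : gapg (submxcol zs.1 i) = 0 by rewrite /gapg !subrr dot0r addr0.
  rewrite g0 in h1.
  have h2 := gapg_le z (zi i).
  rewrite /lyap_fst /slack -/(delta z i) in h1 h2 *.
  have xE : submxcol (xb z) i - submxcol zs.1 i = delta z i + (submxcol z.1 i - submxcol zs.1 i).
    by rewrite /delta addrA subrK.
  rewrite xE in h1 *; move: h1 h2.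
  move: (delta z i) (submxcol z.1 i - submxcol zs.1 i) => D X.
  move: (gapg (submxcol (xb z) i)) (gapg (submxcol z.1 i)) => G G0.
  move: (submxcol (r z) i) (submxcol (a z) i) => ri ai.
  rewrite !(dotDl, dotDr) (dotC X D) subr0.
  set B := \sum_j _.
  move: (dot ri D) (dot ri X) (dot ai D) (dot ai X) (dot D D) (dot D X) (dot X X).
  move=> rD rX aD aX DD DX XX h1 h2.
  have t0 := htau i; have p0 := hp i; have pq := pmin_le p i.
  have c0 : 0 <= p i / pmin p - 1 by rewrite subr_ge0 ler_pdivlMr // mul1r.
  have h3 := ler_wpM2l c0 h2.
  rewrite -subr_ge0 in h1; rewrite -subr_ge0 in h3.
  rewrite -oppr_ge0.
  rewrite [leRHS](_ : _ = (- (rD + aD + (rX + aX)) - (tau i)^-1 * (DD + DX) - G) +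
    ((p i / pmin p - 1) * (- (rD + aD) - (tau i)^-1 * DD) - (p i / pmin p - 1) * (G - G0))).
    apply: addr_ge0; [apply: le_trans h1 _|apply: le_trans h3 _]; lra.
  by field; rewrite !gt_eqF.
have split6 (t1 t2 t3 t4 t5 t6 : 'I_n -> R) :
    (forall i, t1 i + t2 i + t3 i + t4 i + t5 i + t6 i <= 0) ->
    \sum_i t1 i + \sum_i t2 i + \sum_i t3 i + \sum_i t4 i + \sum_i t5 i + \sum_i t6 i <= 0.
  by move=> t; rewrite -!big_split /=; exact: sumr_le0.
have := split6 _ _ _ _ _ _ primal; rewrite -[X in _ + X + _ + _ + _]mulr_sumr => hx.
rewrite /lyapunov /decrease; lra.
Qed.

(** * Limits along one realization *)

Lemma gap_coef_ge0 i : 0 <= (pmin p)^-1 - (p i)^-1.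
Proof. by rewrite subr_ge0 lef_pV2 ?posrE // pmin_le. Qed.

Lemma lyap_weight_gt0 i : 0 < (2 * tau i * p i)^-1.
Proof. by rewrite invr_gt0 !mulr_gt0. Qed.

Lemma lyap_weight_dual_gt0 j : 0 < (2 * sigma j * pi_dual A p j)^-1.
Proof. by rewrite invr_gt0 !mulr_gt0 // pi_dual_gt0. Qed.

Lemma lyapunov_ge0 z : edom g z.1 -> 0 <= lyapunov z.
Proof.
move=> /(edom_blocks proper_g hgsep) zi; apply: addr_ge0; first apply: addr_ge0.
- apply: sumr_ge0 => i _; apply: addr_ge0; apply: mulr_ge0.
  + exact: ltW (lyap_weight_gt0 i).
  + exact: dot_ge0.
  + exact: gap_coef_ge0.
  + exact: gapg_ge0.
- apply: sumr_ge0 => j _; apply: mulr_ge0 (dot_ge0 _).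
  exact: ltW (lyap_weight_dual_gt0 j).
- by rewrite mulr_ge0 ?gapf_ge0 // invr_ge0 ltW.
Qed.

Lemma decrease_parts z :
  [/\ forall i, gapg (submxcol (xb z) i) <= decrease z,
      forall i, slack i / (2 * pmin p) * dot (delta z i) (delta z i) <= decrease z,
      forall j, (2 * sigma j)^-1 * dot (submxcol (yb z) j - submxcol z.2 j)
                  (submxcol (yb z) j - submxcol z.2 j) <= decrease z,
      gapf z.1 <= decrease z & 0 <= decrease z].
Proof.
have g0 i : 0 <= gapg (submxcol (xb z) i).
  by apply: gapg_ge0; exact: ((edom_blocks proper_g hgsep _).1 (xbar_edom z)).
have d0 i : 0 <= slack i / (2 * pmin p) * dot (delta z i) (delta z i).
  by rewrite mulr_ge0 ?dot_ge0 // divr_ge0 ?(ltW (slack_gt0 i)) // mulr_ge0 // ltW.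
have s0 j : 0 <= (2 * sigma j)^-1 * dot (submxcol (yb z) j - submxcol z.2 j)
    (submxcol (yb z) j - submxcol z.2 j).
  by rewrite mulr_ge0 ?dot_ge0 // invr_ge0 mulr_ge0 // ltW.
have h0 := gaph_ge0 (ybar_edom z); have f0 := gapf_ge0 z.1.
have gd0 i : 0 <= gapg (submxcol (xb z) i) +
  slack i / (2 * pmin p) * dot (delta z i) (delta z i) by rewrite addr_ge0.
have sum_ge (I : finType) (F : I -> R) i : (forall i, 0 <= F i) -> F i <= \sum_i F i.
  by move=> F0; rewrite (bigD1 i) //= lerDl sumr_ge0.
have S1 : 0 <= \sum_i (gapg (submxcol (xb z) i) +
  slack i / (2 * pmin p) * dot (delta z i) (delta z i)) by rewrite sumr_ge0.
have S2 : 0 <= \sum_j (2 * sigma j)^-1 * dot (submxcol (yb z) j - submxcol z.2 j)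
    (submxcol (yb z) j - submxcol z.2 j) by rewrite sumr_ge0.
rewrite /decrease; split=> [i|i|j||]; try lra.
- by have := sum_ge _ _ i gd0; have := d0 i; rewrite /= -/(delta z i); lra.
- by have := sum_ge _ _ i gd0; have := g0 i; rewrite /= -/(delta z i); lra.
- by have := sum_ge _ _ j s0; rewrite /=; lra.
Qed.

Definition sqdist (z : bvec R d * bvec R e) : R :=
  wnormsq (blockdiag d (fun i => (2 * tau i * p i)^-1)) (z.1 - zs.1) +
  wnormsq (blockdiag e (fun j => (2 * sigma j * pi_dual A p j)^-1)) (z.2 - zs.2).

(** The Lyapunov function is a squared distance to the saddle point up to gaps
    that vanish along almost every path. *)
Lemma lyapunov_sqdist z : lyapunov z = sqdist z +
  (\sum_i ((pmin p)^-1 - (p i)^-1) * gapg (submxcol z.1 i) + (pmin p)^-1 * gapf z.1).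
Proof.
rewrite /lyapunov /sqdist /lyap_fst /lyap_snd big_split /=.
rewrite !wnormsq_blockdiag.
have -> : \sum_i (2 * tau i * p i)^-1 *
    dot (submxcol (z.1 - zs.1) i) (submxcol (z.1 - zs.1) i) =
  \sum_i (2 * tau i * p i)^-1 * dot (submxcol z.1 i - submxcol zs.1 i)
      (submxcol z.1 i - submxcol zs.1 i).
  by apply: eq_bigr => i _; rewrite submxcolB.
have -> : \sum_j (2 * sigma j * pi_dual A p j)^-1 *
    dot (submxcol (z.2 - zs.2) j) (submxcol (z.2 - zs.2) j) =
  \sum_j (2 * sigma j * pi_dual A p j)^-1 * dot (submxcol z.2 j - submxcol zs.2 j)
      (submxcol z.2 j - submxcol zs.2 j).
  by apply: eq_bigr => j _; rewrite submxcolB.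
ring.
Qed.

Section Path.
Variables (z0 : bvec R d * bvec R e) (s : nat -> 'I_n).
Local Notation z_ := (purecd f g h A theta tau sigma z0 s).
Hypothesis often : forall i L, exists2 k, (L <= k)%N & s k = i.
Hypothesis decrease0 : (fun k => decrease (z_ k)) @ \oo --> 0.

(** Block [i] of [z_ k] is block [i] of [xb (z_ l)] for the last time [l] at
    which [i] was drawn, and this time tends to infinity. *)
Lemma gapg_path_cvg0 i : edom g z0.1 ->
  (fun k => gapg (submxcol (z_ k).1 i)) @ \oo --> 0.
Proof.
move=> dom0; apply/cvgrPdist_le => eps e0.
have domi k : edom (@gi i) (submxcol (z_ k).1 i).
  elim: k => [|k IH] /=; first exact: ((edom_blocks proper_g hgsep _).1 dom0).
  exact: step_edom_block.
have /cvgrPdist_le/(_ _ e0)[K _ HK] := decrease0.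
have [k1 Kk1 sk1] := often i K.
exists k1.+1 => // k /= k1k; rewrite sub0r normrN ger0_norm ?gapg_ge0 //.
elim: k k1k => // k IH; rewrite ltnS leq_eqVlt => /orP[/eqP <-|k1k].
  rewrite /= step_fst_block sk1 eqxx.
  have [/(_ i) h1 _ _ _ h2] := decrease_parts (z_ k1).
  by apply: le_trans h1 _; have := HK k1 Kk1; rewrite sub0r normrN ger0_norm.
rewrite /= step_fst_block; case: eqP => [ik|_]; last exact: IH.
have [/(_ i) h1 _ _ _ h2] := decrease_parts (z_ k).
apply: le_trans h1 _; have := HK k (leq_trans Kk1 (ltnW k1k)).
by rewrite sub0r normrN ger0_norm.
Qed.

Lemma sqdist_path_cvg : edom g z0.1 -> cvgn (fun k => lyapunov (z_ k)) ->
  cvgn (fun k => sqdist (z_ k)).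
Proof.
move=> dom0 cvl.
have -> : (fun k => sqdist (z_ k)) = (fun k => lyapunov (z_ k) -
  (\sum_i ((pmin p)^-1 - (p i)^-1) * gapg (submxcol (z_ k).1 i) + (pmin p)^-1 * gapf (z_ k).1)).
  by apply/funext => k; rewrite lyapunov_sqdist addrK.
apply: is_cvgB => //; apply: is_cvgD.
  apply/cvg_ex; exists (\sum_i ((pmin p)^-1 - (p i)^-1) * 0); apply: cvg_bigsum => i.
  by apply: cvgM; [exact: cvg_cst|exact: gapg_path_cvg0].
apply: is_cvgM; first exact: is_cvg_cst.
apply/cvg_ex; exists 0; apply: (@cvg0_le _ _ _ 1 _ _ _ decrease0) => // k.
  exact: gapf_ge0.
by rewrite mul1r; have [] := decrease_parts (z_ k).
Qed.

Lemma xbar_path_cvg0 : (fun k => xb (z_ k) - (z_ k).1) @ \oo --> (0 : bvec R d).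
Proof.
apply: cvg_dot0.
have hd i : (fun k => dot (delta (z_ k) i) (delta (z_ k) i)) @ \oo --> 0.
  apply: (@cvg0_le _ _ _ (slack i / (2 * pmin p)) _ _ _ decrease0).
  - by rewrite divr_gt0 ?slack_gt0 // mulr_gt0.
  - by move=> k; exact: dot_ge0.
  - by move=> k; have [] := decrease_parts (z_ k).
have -> : (fun k => dot (xb (z_ k) - (z_ k).1 - 0) (xb (z_ k) - (z_ k).1 - 0)) =
    (fun k => \sum_i dot (delta (z_ k) i) (delta (z_ k) i)).
  apply/funext => k; rewrite subr0 dot_blocks; apply: eq_bigr => i _.
  by rewrite submxcolB.
exact: cvg_bigsum0.
Qed.

Lemma ybar_path_cvg0 : (fun k => yb (z_ k) - (z_ k).2) @ \oo --> (0 : bvec R e).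
Proof.
apply: cvg_dot0.
have hd j : (fun k => dot (submxcol (yb (z_ k)) j - submxcol (z_ k).2 j)
    (submxcol (yb (z_ k)) j - submxcol (z_ k).2 j)) @ \oo --> 0.
  apply: (@cvg0_le _ _ _ (2 * sigma j)^-1 _ _ _ decrease0).
  - by rewrite invr_gt0 mulr_gt0.
  - by move=> k; exact: dot_ge0.
  - by move=> k; have [] := decrease_parts (z_ k).
have -> : (fun k => dot (yb (z_ k) - (z_ k).2 - 0) (yb (z_ k) - (z_ k).2 - 0)) =
    (fun k => \sum_j dot (submxcol (yb (z_ k)) j - submxcol (z_ k).2 j)
    (submxcol (yb (z_ k)) j - submxcol (z_ k).2 j)).
  apply/funext => k; rewrite subr0 dot_blocks; apply: eq_bigr => j _.
  by rewrite submxcolB.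
exact: cvg_bigsum0.
Qed.

(** The optimality conditions of the proximal steps pass to the limit along a
    convergent subsequence, since [xb (z_ k) - (z_ k).1] and
    [yb (z_ k) - (z_ k).2] vanish: cluster points are saddle points. *)
Lemma path_cluster : cvgn (fun k => sqdist (z_ k)) ->
  exists l : bvec R d * bvec R e, exists2 phi : nat -> nat, (forall j, (j <= phi j)%N) &
    [/\ saddle_points f g h A l, (fun j => (z_ (phi j)).1) @ \oo --> l.1 &
        (fun j => (z_ (phi j)).2) @ \oo --> l.2].
Proof.
move=> cvs; have [M [_ HM]] := cvg_seq_bounded cvs.
have bd k : sqdist (z_ k) <= M + 1.
  by apply: le_trans (ler_norm _) _; apply: (HM (M + 1)) => //; rewrite ltrDl.
have q1 u := wnormsq_ge0 (d := d) u lyap_weight_gt0.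
have q2 u := wnormsq_ge0 (d := e) u lyap_weight_dual_gt0.
have c1 := pmin_gt0 lyap_weight_gt0; have c2 := pmin_gt0 lyap_weight_dual_gt0.
have bx k : dot ((z_ k).1 - zs.1) ((z_ k).1 - zs.1) <=
    (pmin (fun i => (2 * tau i * p i)^-1))^-1 * (M + 1).
  rewrite -ler_pdivrMl ?invr_gt0 // invrK.
  apply: le_trans (wnormsq_ge _ lyap_weight_gt0) _; apply: le_trans (bd k).
  by rewrite /sqdist lerDl.
have by_ k : dot ((z_ k).2 - zs.2) ((z_ k).2 - zs.2) <=
    (pmin (fun j => (2 * sigma j * pi_dual A p j)^-1))^-1 * (M + 1).
  rewrite -ler_pdivrMl ?invr_gt0 // invrK.
  apply: le_trans (wnormsq_ge _ lyap_weight_dual_gt0) _; apply: le_trans (bd k).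
  by rewrite /sqdist lerDr.
have [lx [phi1 jphi1 cvx]] := bounded_subseq bx.
have [ly [phi2 jphi2 cvy]] := bounded_subseq (fun k => by_ (phi1 k)).
pose phi := phi1 \o phi2.
have jphi j : (j <= phi j)%N by exact: leq_trans (jphi2 j) (jphi1 _).
have xl : (fun j => (z_ (phi j)).1) @ \oo --> lx + zs.1.
  rewrite (_ : (fun j => _) = (fun j => ((z_ (phi j)).1 - zs.1) + zs.1)).
    by apply: cvgD; [exact: (cvg_reindex jphi2 cvx)|exact: cvg_cst].
  by apply/funext => j; rewrite subrK.
have yl : (fun j => (z_ (phi j)).2) @ \oo --> ly + zs.2.
  rewrite (_ : (fun j => _) = (fun j => ((z_ (phi j)).2 - zs.2) + zs.2)).
    by apply: cvgD; [exact: cvy|exact: cvg_cst].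
  by apply/funext => j; rewrite subrK.
have dx0 := cvg_reindex jphi xbar_path_cvg0; have dy0 := cvg_reindex jphi ybar_path_cvg0.
set l1 := lx + zs.1 in xl; set l2 := ly + zs.2 in yl.
have xbl : (fun j => xb (z_ (phi j))) @ \oo --> l1.
  rewrite -[l1]add0r (_ : (fun j => _) =
    (fun j => (xb (z_ (phi j)) - (z_ (phi j)).1) + (z_ (phi j)).1)).
    by apply: cvgD; [exact: dx0|exact: xl].
  by apply/funext => j; rewrite subrK.
have ybl : (fun j => yb (z_ (phi j))) @ \oo --> l2.
  rewrite -[l2]add0r (_ : (fun j => _) =
    (fun j => (yb (z_ (phi j)) - (z_ (phi j)).2) + (z_ (phi j)).2)).
    by apply: cvgD; [exact: dy0|exact: yl].
  by apply/funext => j; rewrite subrK.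
have dx0' : (fun j => (z_ (phi j)).1 - xb (z_ (phi j))) @ \oo --> (0 : bvec R d).
  by rewrite -(subrr l1); apply: cvgB; [exact: xl|exact: xbl].
have dy0' : (fun j => (z_ (phi j)).2 - yb (z_ (phi j))) @ \oo --> (0 : bvec R e).
  by rewrite -(subrr l2); apply: cvgB; [exact: yl|exact: ybl].
have sg : subdiff g l1 (blockdiag d (fun i => (tau i)^-1) *m 0 - (grad f l1 + A^T *m l2)).
  have [_ lsc _] := hg.
  apply: (subdiff_closed proper_g lsc xbl _ (fun j => xbar_subdiff (z_ (phi j)))).
  apply: cvgB; first exact: cvg_mulmx.
  apply: cvgD; last exact: cvg_mulmx.
  exact: (grad_cvg fcvx hfdiff xl).
have sh : subdiff (conjugate h) l2 (blockdiag e (fun j => (sigma j)^-1) *m 0 + A *m l1).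
  have [_ lsc _] := conjugate_proper_lsc_convex hh.
  apply: (subdiff_closed proper_h lsc ybl _ (fun j => ybar_subdiff (z_ (phi j)))).
  by apply: cvgD; exact: cvg_mulmx.
rewrite mulmx0 sub0r in sg; rewrite mulmx0 add0r in sh.
exists (l1, l2), phi => //; split=> //; split.
  exists (- (grad f l1 + A^T *m l2)) => //=.
  by rewrite opprD addrA subrr sub0r addNr.
by exists (A *m l1) => //=; rewrite subrr.
Qed.

End Path.

End Lyapunov.
Section Opial.
Variables (z0 : bvec R d * bvec R e) (s : nat -> 'I_n).
Local Notation z_ := (purecd f g h A theta tau sigma z0 s).

(** Opial's argument: if the distances to a dense set of saddle points converge,
    a cluster point that is a saddle point is the limit. *)
Lemma path_cvg (C : Type) (c : C -> bvec R d * bvec R e) (l : bvec R d * bvec R e)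
    (phi : nat -> nat) :
  (forall eps, 0 < eps -> exists q,
      dot (l.1 - (c q).1) (l.1 - (c q).1) + dot (l.2 - (c q).2) (l.2 - (c q).2) < eps) ->
  (forall q, cvgn (fun k => sqdist (c q) (z_ k))) ->
  (forall j, (j <= phi j)%N) ->
  (fun j => (z_ (phi j)).1) @ \oo --> l.1 ->
  (fun j => (z_ (phi j)).2) @ \oo --> l.2 ->
  z_ @ \oo --> l.
Proof.
move=> dense cvs jphi xl yl.
pose w1 := fun i => (2 * tau i * p i)^-1.
pose w2 := fun j => (2 * sigma j * pi_dual A p j)^-1.
have w10 : forall i, 0 < w1 i := lyap_weight_gt0.
have w20 : forall j, 0 < w2 j := lyap_weight_dual_gt0.
have lim q : (fun k => sqdist (c q) (z_ k)) @ \oo --> sqdist (c q) l.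
  have /cvg_ex[L hL] := cvs q; suff <- : L = sqdist (c q) l by [].
  have h1 := cvg_reindex jphi hL.
  apply: (norm_cvg_unique h1).
  have xc : (fun j => (z_ (phi j)).1 - (c q).1) @ \oo --> l.1 - (c q).1.
    by apply: cvgB => //; exact: cvg_cst.
  have yc : (fun j => (z_ (phi j)).2 - (c q).2) @ \oo --> l.2 - (c q).2.
    by apply: cvgB => //; exact: cvg_cst.
  by apply: cvgD; apply: cvg_dot => //; exact: cvg_mulmx.
pose W := \sum_i w1 i + \sum_j w2 j.
have W1 : 0 <= \sum_i w1 i by rewrite sumr_ge0 // => i _; exact: ltW.
have W2 : 0 <= \sum_j w2 j by rewrite sumr_ge0 // => j _; exact: ltW.
have sqle z z' : sqdist z z' <=
    W * (dot (z'.1 - z.1) (z'.1 - z.1) + dot (z'.2 - z.2) (z'.2 - z.2)).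
  have h1 := wnormsq_le (z'.1 - z.1) w10; have h2 := wnormsq_le (z'.2 - z.2) w20.
  apply: le_trans (lerD h1 h2) _; rewrite mulrDr lerD // ler_wpM2r ?dot_ge0 //.
    by rewrite lerDl.
  by rewrite lerDr.
have sqtri z z' z'' : sqdist z z'' <= 2 * sqdist z' z'' + 2 * sqdist z z'.
  have h1 := wnormsq_parallelogram (z''.1 - z'.1) (z'.1 - z.1) w10.
  have h2 := wnormsq_parallelogram (z''.2 - z'.2) (z'.2 - z.2) w20.
  by move: h1 h2; rewrite !addrA !subrK /sqdist; lra.
have sq_ge0 z z' : 0 <= sqdist z z' by rewrite addr_ge0 // wnormsq_ge0.
have to0 : (fun k => sqdist l (z_ k)) @ \oo --> 0.
  apply/cvgrPdist_lt => eps e0.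
  have [|q hq] := dense (eps / (8 * (W + 1))).
    by rewrite divr_gt0 // mulr_gt0 // ltr_wpDl // addr_ge0.
  have Wp : 0 < W + 1 by rewrite ltr_wpDl // addr_ge0.
  move: hq; rewrite ltr_pdivlMr ?mulr_gt0 // => hq.
  set D := _ + _ in hq.
  have D0 : 0 <= D by rewrite addr_ge0 ?dot_ge0.
  have h1 : sqdist (c q) l <= W * D by exact: sqle.
  have h2 : sqdist l (c q) <= W * D.
    by have := sqle l (c q); rewrite (dot_subC (c q).1) (dot_subC (c q).2).
  have h3 : W * D < eps / 8 by rewrite ltr_pdivlMr //; nra.
  have lt : sqdist (c q) l < eps / 4 by lra.
  have [K _ HK] := cvgr_lt _ (lim q) _ lt; exists K => // k /HK /= hk.
  rewrite sub0r normrN ger0_norm // (le_lt_trans (sqtri l (c q) (z_ k))) //; lra.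
have c1 : (fun k => (z_ k).1) @ \oo --> l.1.
  apply: cvg_dot0; apply: (cvg0_le (pmin_gt0 w10) _ _ to0) => k; first exact: dot_ge0.
  by apply: le_trans (wnormsq_ge _ w10) _; rewrite /sqdist lerDl wnormsq_ge0.
have c2 : (fun k => (z_ k).2) @ \oo --> l.2.
  apply: cvg_dot0; apply: (cvg0_le (pmin_gt0 w20) _ _ to0) => k; first exact: dot_ge0.
  by apply: le_trans (wnormsq_ge _ w20) _; rewrite /sqdist lerDr wnormsq_ge0.
rewrite (_ : z_ = (fun k => ((z_ k).1, (z_ k).2))); first exact: cvg_pair c1 c2.
by apply/funext => k; case: (z_ k).
Qed.

End Opial.

(** * Almost sure convergence *)

Section Random.
Context {dT : measure_display} {T : measurableType dT} (P : probability T R).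
Hypothesis hsol : saddle_points f g h A !=set0.
Local Notation pcd z0 s := (purecd f g h A theta tau sigma z0 s).

Definition trajectory z0 (s : seq 'I_n) := foldl step z0 s.

Lemma purecd_trajectory z0 (s : nat -> 'I_n) k : pcd z0 s k = trajectory z0 (mkseq s k).
Proof. by elim: k => // k IH; rewrite mkseqS /trajectory foldl_rcons /= IH. Qed.

Lemma trajectory_edom z0 s : edom g z0.1 -> edom g (trajectory z0 s).1.
Proof.
move=> z0dom; elim/last_ind: s => //= s i IH; rewrite /trajectory foldl_rcons.
apply/(edom_blocks proper_g hgsep) => l; apply: step_edom_block.
exact: ((edom_blocks proper_g hgsep _).1 IH).
Qed.

Lemma ae_lyapunov_cvg xi z0 zs : random_draws P p xi -> edom g z0.1 ->
  saddle_points f g h A zs ->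
  {ae P, forall w, cvgn (fun k => lyapunov zs (pcd z0 (xi^~ w) k)) /\
    (fun k => decrease zs (pcd z0 (xi^~ w) k)) @ \oo --> 0}.
Proof.
move=> hxi z0dom hzs.
(* Adding the decreases of the past to the Lyapunov function keeps it a
   supermartingale, whose convergence also makes these decreases summable. *)
pose Q s := lyapunov zs (trajectory z0 s) +
  \sum_(l < size s) decrease zs (trajectory z0 (take l s)).
have dec0 z : 0 <= decrease zs z by have [] := decrease_parts hzs z.
have lyap0 s : 0 <= lyapunov zs (trajectory z0 s).
  by apply: lyapunov_ge0 => //; exact: trajectory_edom.
have Q0 s : 0 <= Q s by rewrite addr_ge0 // sumr_ge0.
have sQ : supermartingale p Q.
  move=> s.
  have -> : \sum_i p i * Q (rcons s i) = \sum_i p i * lyapunov zs (step (trajectory z0 s) i) +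
    (\sum_(l < size s) decrease zs (trajectory z0 (take l s)) + decrease zs (trajectory z0 s)).
    rewrite -[X in _ = _ + X]mul1r -hp1 mulr_suml -big_split /=; apply: eq_bigr => i _.
    rewrite -mulrDr /Q size_rcons big_ord_recr /= {1}/trajectory foldl_rcons.
    rewrite -cats1 take_size_cat //; congr (_ * (_ + (_ + _))).
    by apply: eq_bigr => l _; rewrite takel_cat // ltnW.
  have := lyapunov_decrease hzs (trajectory_edom s z0dom); rewrite /Q; lra.
apply: filterS (supermartingale_cvg hp hp1 hxi Q0 sQ) => w cv.
apply: cvgn_of_summable => [k|k|]; first by rewrite purecd_trajectory.
  exact: dec0.
rewrite [X in cvgn X](_ : _ = (fun k => Q (prefix xi k w))) //; apply/funext => k.
rewrite /Q /prefix size_mkseq purecd_trajectory; congr (_ + _).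
apply: eq_bigr => l _; rewrite purecd_trajectory.
by rewrite /mkseq -map_take take_iota (minn_idPl (ltnW (ltn_ord l))).
Qed.

Lemma ae_cvg_from_domain xi z0 : random_draws P p xi -> edom g z0.1 ->
  {ae P, forall w, exists2 zstar, saddle_points f g h A zstar
    & pcd z0 (xi^~ w) @ \oo --> zstar}.
Proof.
move=> hxi z0dom; have [c [cS cdense]] := countable_dense hsol.
have := ae_forall_countable (fun q => ae_lyapunov_cvg hxi z0dom (cS q)).
apply: filterS2 (ae_drawn_infinitely_often hp hp1 hxi) => w often cv.
have sq q : cvgn (fun k => sqdist (c q) (pcd z0 (xi^~ w) k)).
  by have [cl d0] := cv q; exact: (sqdist_path_cvg (cS q) often d0 z0dom cl).
have q0 := (0, 0, 0%N) : 'cV[rat]_(\sum_i d i)%N * 'cV[rat]_(\sum_j e j)%N * nat.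
have [l [phi jphi [lS xl yl]]] := path_cluster (cS q0) (cv q0).2 (sq q0).
exists l => //; apply: (path_cvg _ sq jphi xl yl) => eps e0.
exact: cdense.
Qed.

(** The Lyapunov function makes sense only where [g] is finite, which holds at the
    iterates once every block has been drawn; until then only countably many prefixes of
    draws have to be considered. *)
Theorem ae_cvg xi z0 : random_draws P p xi ->
  {ae P, forall w, exists2 zstar, saddle_points f g h A zstar
    & pcd z0 (xi^~ w) @ \oo --> zstar}.
Proof.
move=> hxi.
have aes : {ae P, forall w, forall s : seq 'I_n, edom g (trajectory z0 s).1 ->
    exists2 zstar, saddle_points f g h A zstar
    & pcd (trajectory z0 s) (fun k => xi (k + size s)%N w) @ \oo --> zstar}.
  apply: ae_forall_countable => s.
  have [sdom|ndom] := pselect (edom g (trajectory z0 s).1); last exact: aeW.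
  apply: filterS (ae_cvg_from_domain (random_draws_shift hxi (size s)) sdom) => w.
  by [].
apply: filterS2 aes (ae_drawn_infinitely_often hp hp1 hxi) => w aes often.
have ex i : exists k, xi k w = i by have [k _ ki] := often i 0%N; exists k.
have [t ht] := choice ex.
pose K := (\max_i (t i).+1)%N.
have tK i : (t i < K)%N by exact: (leq_bigmax i).
have dom k i : (t i < k)%N -> edom (@gi i) (submxcol (pcd z0 (xi^~ w) k).1 i).
  elim: k => // k IH; rewrite ltnS leq_eqVlt => /orP[/eqP <-|tk] /=.
    rewrite step_fst_block ht eqxx.
    exact: ((edom_blocks proper_g hgsep _).1 (xbar_edom _)).
  exact: step_edom_block (IH tk).
have Kdom : edom g (trajectory z0 (prefix xi K w)).1.
  by rewrite -purecd_trajectory; apply/(edom_blocks proper_g hgsep) => i; exact: dom.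
have [l lS cvl] := aes _ Kdom; exists l => //.
rewrite size_mkseq -purecd_trajectory in cvl.
have shift k : pcd (pcd z0 (xi^~ w) K) (fun k => xi (k + K)%N w) k = pcd z0 (xi^~ w) (k + K)%N.
  by elim: k => //= k ->.
rewrite (funext shift) in cvl; move=> B /cvl[k0 _ hk0]; exists (k0 + K)%N => // k k0k.
have Kk : (K <= k)%N := leq_trans (leq_addl _ _) k0k.
have kK : (k0 <= k - K)%N by rewrite leq_subRL // addnC.
have hB : B (pcd z0 (xi^~ w) (k - K + K)%N) := hk0 _ kK.
by rewrite subnK in hB.
Qed.

End Random.

End Step.

Theorem theorem1 (R : realType) (n m : nat) (d : 'I_n -> nat) (e : 'I_m -> nat)
    (f : bvec R d -> R) (g : bvec R d -> \bar R) (h : bvec R e -> \bar R)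
    (gi : forall i : 'I_n, 'cV[R]_(d i) -> \bar R)
    (A : 'M[R]_(\sum_j e j, \sum_i d i)%N)
    (beta : 'I_n -> R) (p : 'I_n -> R)
    (theta : 'I_m -> R) (tau : 'I_n -> R) (sigma : 'I_m -> R)
    (dT : measure_display) (T : measurableType dT) (P : probability T R)
    (xi : nat -> T -> 'I_n) (z0 : bvec R d * bvec R e)
    (hf : proper_lsc_convex (fun x => (f x)%:E))
    (hg : proper_lsc_convex g)
    (hh : proper_lsc_convex h)
    (hgsep : forall x, g x = (\sum_i gi i (submxcol x i))%E)
    (hfdiff : forall x, differentiable f x)
    (hfLip : forall (x : bvec R d) (i : 'I_n) (u : 'cV[R]_(d i)),
      f (x + Ublock u)
        <= f x + dot (submxcol (grad f x) i) u + beta i / 2 * enorm u ^+ 2)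
    (hsol : saddle_points f g h A !=set0)
    (hri : relint [set u - A *m x | u in edom h & x in edom g] 0)
    (hp : forall i, 0 < p i)
    (hp1 : \sum_i p i = 1)
    (hA : forall j : 'I_m, exists i : 'I_n, submxblock A j i != 0)
    (htheta : forall j, theta j = pi_dual A p j / pmin p)
    (htau : forall i, 0 < tau i)
    (hsigma : forall j, 0 < sigma j)
    (* the quotient is taken in \bar R: it is +oo when the denominator is 0 *)
    (hstep : forall i : 'I_n,
      ((tau i)%:E <
       (2 * p i - pmin p)%:E /
       (beta i * p i + (pmin p)^-1 * p i *
          \sum_j pi_dual A p j * sigma j * opnorm (submxblock A j i) ^+ 2)%:E)%E)
    (hxi : random_draws P p xi) :
  {ae P, forall w, exists2 zstar, saddle_points f g h A zstar
    & (purecd f g h A theta tau sigma z0 (fun k => xi k w) k)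
        @[k --> \oo] --> zstar}.
Proof.
exact: (ae_cvg hf hg hh hgsep hfdiff hfLip hp hp1 hA htheta htau hsigma hstep hsol z0 hxi).
Qed.
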